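(* Let $G$ be a compact abelian group with dual group $\Gamma$, and let $\Lambda\subseteq\Gamma$ be such that there exists a surjective (bounded linear) projection $P\colon L^\infty_\Lambda\to\mathcal C_\Lambda$. Then $\mathcal C_\Lambda$ does not contain $c_0$. Moreover, every Riemann-integrable function in $L^\infty_\Lambda$ is actually in $\mathcal C_\Lambda$; that is, every element of $L^\infty_\Lambda$ which has a Riemann-integrable representative also has a continuous representative.
   Context: $G$ carries its normalized Haar measure $m$, and $\hat f(\gamma)=\int_G f\,\overline\gamma\,dm$. $L^\infty_\Lambda$ (resp. $\mathcal C_\Lambda$) is the subspace of those $f\in L^\infty(G)$ (resp. of continuous $f\colon G\to\mathbb C$) with $\hat f(\gamma)=0$ for all $\gamma\in\Gamma\setminus\Lambda$; $\mathcal C_\Lambda$ is viewed as a closed subspace of $L^\infty_\Lambda$. A function $h\colon G\to\mathbb C$ is Riemann-integrable if it is bounded and almost everywhere continuous (i.e. its set of discontinuity points is $m$-null). A Banach space contains $c_0$ if it has a closed subspace isomorphic to $c_0$. *)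

(* Defs.v *)
From HB Require Import structures.
From mathcomp Require Import all_boot all_order all_algebra.
From mathcomp Require Import ring_quotient.
From mathcomp Require Import all_classical all_reals all_analysis.
From mathcomp Require Import measurable_realfun ess_sup_inf.
From mathcomp Require Import complex.

Set Implicit Arguments.
Unset Strict Implicit.
Unset Printing Implicit Defensive.

Import Order.TTheory GRing.Theory Num.Theory.
Import numFieldNormedType.Exports.
Import Normc.

Local Open Scope classical_set_scope.
Local Open Scope complex_scope.
Local Open Scope ring_scope.

(* The topology and the norm of the complex field; the norm of a vector of a
   normed space over R[i] is an element of R[i], namely a real one.  The modulus
   as an element of R is normc. *)
HB.instance Definition _ (R : realType) := NormedModule.copy R[i] R[i]^o.

Section normc_extra.
Variable R : realType.
Implicit Types a b : R[i].

Lemma normrE a : `|a| = (normc a)%:C.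
Proof. by case: a. Qed.

Lemma normc_ge0 a : 0 <= normc a.
Proof. by case: a => a b; exact: sqrtr_ge0. Qed.

Lemma ReD a b : complex.Re (a + b) = complex.Re a + complex.Re b.
Proof. by case: a; case: b. Qed.

Lemma ImD a b : complex.Im (a + b) = complex.Im a + complex.Im b.
Proof. by case: a; case: b. Qed.

Lemma ReM a b :
  complex.Re (a * b) = complex.Re a * complex.Re b - complex.Im a * complex.Im b.
Proof. by case: a; case: b. Qed.

Lemma ImM a b :
  complex.Im (a * b) = complex.Re a * complex.Im b + complex.Im a * complex.Re b.
Proof. by case: a; case: b => *; rewrite /= [RHS]addrC addrC. Qed.

End normc_extra.

Definition cmeasurable d (T : measurableType d) (R : realType) (f : T -> R[i]) :=
  measurable_fun [set: T] (fun x => complex.Re (f x)) /\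
  measurable_fun [set: T] (fun x => complex.Im (f x)).

Definition cintegral d (T : measurableType d) (R : realType)
    (mu : {measure set T -> \bar R}) (f : T -> R[i]) : R[i] :=
  (\int[mu]_x complex.Re (f x)) +i* (\int[mu]_x complex.Im (f x)).

Section ess_norm.
Context d (T : measurableType d) (R : realType) (mu : probability T R).
Implicit Types (f g : T -> R[i]) (a : R[i]).

Definition ess_norm f : \bar R := ess_sup mu (fun x => (normc (f x))%:E).

Local Open Scope ereal_scope.

Lemma ess_normD f g : ess_norm (f + g)%R <= ess_norm f + ess_norm g.
Proof.
apply: le_trans (ess_supD _ _ _); apply: le_ess_sup; apply: nearW => x /=.
by rewrite -EFinD lee_fin; exact: le_normcD.
Qed.

Let muT_gt0 : 0 < mu [set: T].
Proof. by rewrite probability_setT lte01. Qed.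

Lemma ess_normZ a f : ess_norm (a *: f) = (normc a)%:E * ess_norm f.
Proof.
rewrite /ess_norm -ess_supZl ?normc_ge0//; congr (ess_sup _ _).
by apply/funext => x /=; rewrite -EFinM -normcM.
Qed.

Lemma ess_norm_ge0 f : 0 <= ess_norm f.
Proof. by apply: ess_sup_gee => //; apply: nearW => x; rewrite lee_fin normc_ge0. Qed.

Lemma ess_norm_ae f g :
  {ae mu, forall x, f x = g x} -> ess_norm f = ess_norm g.
Proof. by move=> fg; apply: eq_ess_sup; apply: filterS fg => x ->. Qed.

Lemma ess_norm_eq0 f : ess_norm f = 0 -> {ae mu, forall x, f x = 0%R}.
Proof.
move=> f0; have := @ess_sup_ge _ _ _ mu (fun x => (normc (f x))%:E).
rewrite -/(ess_norm f) f0; apply: filterS => x; rewrite lee_fin => fx0.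
by apply: eq0_normc; apply/eqP; rewrite eq_le fx0 normc_ge0.
Qed.

End ess_norm.

(* L^oo(mu) with complex values.  Functions measurable for the completion of mu
   are a.e. equal to measurable ones, so they yield the same classes. *)
Section Linfty.
Context d (T : measurableType d) (R : realType) (mu : probability T R).

Definition ess_bounded : {pred T -> R[i]} :=
  mem [set f | cmeasurable f /\ (ess_norm mu f < +oo)%E].

Lemma ess_bounded_submod : submod_closed ess_bounded.
Proof.
split.
  rewrite inE; split; first by split; exact: measurable_cst.
  have -> : ess_norm mu 0 = ess_norm mu (0 *: 0).
    by congr (ess_norm _); rewrite scaler0.
  by rewrite ess_normZ normc0 mul0e.
move=> a f g; rewrite !inE => -[[mRf mIf] nf] [[mRg mIg] ng]; split; [split|].
- apply: (eq_measurable_fun (fun x => complex.Re a * complex.Re (f x) -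
      complex.Im a * complex.Im (f x) + complex.Re (g x))).
    by move=> x _; rewrite /= ReD ReM.
  apply: measurable_funD => //; apply: measurable_funB;
    by apply: measurable_funM => //; exact: measurable_cst.
- apply: (eq_measurable_fun (fun x => complex.Re a * complex.Im (f x) +
      complex.Im a * complex.Re (f x) + complex.Im (g x))).
    by move=> x _; rewrite /= ImD ImM.
  apply: measurable_funD => //; apply: measurable_funD;
    by apply: measurable_funM => //; exact: measurable_cst.
- apply: le_lt_trans (ess_normD _ _ _) _; rewrite lte_add_pinfty//.
  rewrite ess_normZ; have := ess_norm_ge0 mu f; move: nf.
  by case: (ess_norm mu f) => // r _ _; rewrite -EFinM ltry.
Qed.

HB.instance Definition _ :=
  GRing.isSubmodClosed.Build _ _ ess_bounded ess_bounded_submod.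

Record ebfun := EBFun { ebfun_val :> T -> R[i] ; _ : ebfun_val \in ess_bounded }.

HB.instance Definition _ := [isSub for ebfun_val].
HB.instance Definition _ := [Choice of ebfun by <:].
HB.instance Definition _ := [SubChoice_isSubLmodule of ebfun by <:].

Definition ae_null : {pred ebfun} :=
  mem [set f : ebfun | {ae mu, forall x, f x = 0}].

Lemma ae_null_submod : submod_closed ae_null.
Proof.
split; first by rewrite inE; exact: nearW.
move=> a f g; rewrite !inE /= => f0 g0; near=> x => /=.
have fx0 : f x = 0 by near: x.
have gx0 : g x = 0 by near: x.
by transitivity (a * f x + g x) => [//|]; rewrite fx0 gx0 mulr0 addr0.
Unshelve. all: by end_near. Qed.

HB.instance Definition _ :=
  GRing.isSubmodClosed.Build _ _ ae_null ae_null_submod.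

Definition Linfty : Type := @Quotient.quot ebfun ae_null.

HB.instance Definition _ := Choice.on Linfty.
HB.instance Definition _ := EqQuotient.on Linfty.
HB.instance Definition _ := GRing.Zmodule.on Linfty.

(* An arbitrary representative of the class f. *)
Definition Linfty_fun (f : Linfty) : T -> R[i] := ebfun_val (repr f).
Coercion Linfty_fun : Linfty >-> Funclass.

Local Open Scope quotient_scope.

Lemma Linfty_piP (f g : ebfun) :
  \pi_Linfty f = \pi_Linfty g <-> {ae mu, forall x, f x = g x}.
Proof.
split=> [/eqP|fg].
  rewrite piE /Quotient.equiv inE /=; apply: filterS => x fg.
  by apply/eqP; rewrite -subr_eq0; apply/eqP.
apply/eqP; rewrite piE /Quotient.equiv inE /=.
by apply: filterS fg => x fg; transitivity (f x - g x) => [//|]; rewrite fg subrr.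
Qed.

Lemma Linfty_eqP (f g : Linfty) : f = g <-> {ae mu, forall x, f x = g x}.
Proof. by rewrite -[f in f = _]reprK -[g in _ = g]reprK; exact: Linfty_piP. Qed.

Lemma Linfty_pi_ae (f : ebfun) : {ae mu, forall x, (\pi_Linfty f : Linfty) x = f x}.
Proof. by apply/Linfty_piP; rewrite reprK. Qed.

Lemma LinftyD_ae (f g : Linfty) :
  {ae mu, forall x, (f + g : Linfty) x = f x + g x}.
Proof.
have -> : f + g = \pi_Linfty (repr f + repr g).
  by rewrite -[f in LHS]reprK -[g in LHS]reprK; exact: esym (Quotient.pi_add _ _ _).
exact: Linfty_pi_ae.
Qed.

Definition Linfty_scale (a : R[i]) (f : Linfty) : Linfty :=
  \pi_Linfty (a *: repr f).

Lemma Linfty_scale_ae a f : {ae mu, forall x, Linfty_scale a f x = a * f x}.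
Proof. exact: Linfty_pi_ae. Qed.

Lemma Linfty_scaleA a b f :
  Linfty_scale a (Linfty_scale b f) = Linfty_scale (a * b) f.
Proof.
apply/Linfty_eqP; near=> x.
have -> : Linfty_scale a (Linfty_scale b f) x = a * Linfty_scale b f x.
  by near: x; exact: Linfty_scale_ae.
have -> : Linfty_scale b f x = b * f x by near: x; exact: Linfty_scale_ae.
have -> : Linfty_scale (a * b) f x = a * b * f x.
  by near: x; exact: Linfty_scale_ae.
by rewrite mulrA.
Unshelve. all: by end_near. Qed.

Lemma Linfty_scale1 : left_id 1 Linfty_scale.
Proof.
by move=> f; apply/Linfty_eqP; apply: filterS (Linfty_scale_ae 1 f) => x ->;
  rewrite mul1r.
Qed.

Lemma Linfty_scaleDr : right_distributive Linfty_scale +%R.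
Proof.
move=> a f g; apply/Linfty_eqP; near=> x.
have -> : Linfty_scale a (f + g : Linfty) x = a * (f + g : Linfty) x.
  by near: x; exact: Linfty_scale_ae.
have -> : (f + g : Linfty) x = f x + g x by near: x; exact: LinftyD_ae.
have -> : (Linfty_scale a f + Linfty_scale a g : Linfty) x =
    Linfty_scale a f x + Linfty_scale a g x by near: x; exact: LinftyD_ae.
have -> : Linfty_scale a f x = a * f x by near: x; exact: Linfty_scale_ae.
have -> : Linfty_scale a g x = a * g x by near: x; exact: Linfty_scale_ae.
by rewrite mulrDr.
Unshelve. all: by end_near. Qed.

Lemma Linfty_scaleDl f : {morph Linfty_scale^~ f : a b / a + b}.
Proof.
move=> a b; apply/Linfty_eqP; near=> x.
have -> : Linfty_scale (a + b) f x = (a + b) * f x.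
  by near: x; exact: Linfty_scale_ae.
have -> : (Linfty_scale a f + Linfty_scale b f : Linfty) x =
    Linfty_scale a f x + Linfty_scale b f x by near: x; exact: LinftyD_ae.
have -> : Linfty_scale a f x = a * f x by near: x; exact: Linfty_scale_ae.
have -> : Linfty_scale b f x = b * f x by near: x; exact: Linfty_scale_ae.
by rewrite mulrDl.
Unshelve. all: by end_near. Qed.

HB.instance Definition _ := GRing.Zmodule_isLmodule.Build R[i] Linfty
  Linfty_scaleA Linfty_scale1 Linfty_scaleDr Linfty_scaleDl.

Definition Linfty_norm (f : Linfty) : R[i] := (fine (ess_norm mu f))%:C.

Lemma Linfty_normE (f : Linfty) : (fine (ess_norm mu f))%:E = ess_norm mu f.
Proof.
rewrite fineK// ge0_fin_numE ?ess_norm_ge0//.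
by have := valP (repr f); rewrite inE => -[].
Qed.

Lemma Linfty_normD f g : Linfty_norm (f + g) <= Linfty_norm f + Linfty_norm g.
Proof.
rewrite /Linfty_norm -rmorphD lecR -lee_fin EFinD !Linfty_normE.
by rewrite (ess_norm_ae (LinftyD_ae f g)); exact: ess_normD.
Qed.

Lemma Linfty_normZ a f : Linfty_norm (a *: f) = `|a| * Linfty_norm f.
Proof.
rewrite /Linfty_norm normrE -rmorphM; congr (_%:C); apply: EFin_inj.
rewrite EFinM !Linfty_normE -ess_normZ.
exact: ess_norm_ae (Linfty_scale_ae a f).
Qed.

Lemma Linfty_norm0_eq0 f : Linfty_norm f = 0 -> f = 0.
Proof.
case=> f0; have : ess_norm mu f = 0%E by rewrite -Linfty_normE f0.
move=> /ess_norm_eq0 {}f0; rewrite -[LHS]reprK.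
have -> : 0 = \pi_Linfty (0 : ebfun) by rewrite piE.
by apply/Linfty_piP.
Qed.

HB.instance Definition _ := Lmodule_isNormed.Build R[i] Linfty
  Linfty_normD Linfty_normZ Linfty_norm0_eq0.

End Linfty.

Section c0.
Variable R : realType.

Definition null_seq : {pred nat -> R[i]} :=
  mem [set u : nat -> R[i] | u @ \oo --> (0 : R[i])].

Lemma null_seq_submod : submod_closed null_seq.
Proof.
split; first by rewrite inE; exact: cvg_cst.
move=> a u v; rewrite !inE /= => u0 v0.
have -> : (0 : R[i]) = a *: (0 : R[i]) + 0 by rewrite scaler0 addr0.
have au0 := @cvgZl_tmp _ R[i] _ _ _ a _ _ u0.
have auv0 := cvgD (au0 _) v0.
exact: auv0.
Qed.

HB.instance Definition _ :=
  GRing.isSubmodClosed.Build _ _ null_seq null_seq_submod.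

Record c0 := C0 { c0_val :> nat -> R[i] ; _ : c0_val \in null_seq }.

HB.instance Definition _ := [isSub for c0_val].
HB.instance Definition _ := [Choice of c0 by <:].
HB.instance Definition _ := [SubChoice_isSubLmodule of c0 by <:].

Definition c0_sup (u : c0) : R := sup (range (fun n => normc (u n))).

Lemma c0_has_sup (u : c0) : has_sup (range (fun n => normc (u n))).
Proof.
split; first by exists (normc (u 0%N)), 0%N.
have : cvgn (u : nat -> R[i]).
  by apply/cvg_ex; exists 0; have := valP u; rewrite inE.
move=> /cvg_seq_bounded/pinfty_ex_gt0[M M_gt0 /= uM].
exists (complex.Re M); apply/ubP => _ [n _ <-].
have /(_ n I) := uM; rewrite normrE.
by case: M {M_gt0 uM} => a b; rewrite lecE /= => /andP[].
Qed.

Lemma c0_sup_ge (u : c0) n : normc (u n) <= c0_sup u.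
Proof. by apply: (sup_upper_bound (c0_has_sup u)); exists n. Qed.

Lemma c0_sup_le (u : c0) M : (forall n, normc (u n) <= M) -> c0_sup u <= M.
Proof.
move=> uM; apply: ge_sup; first by case: (c0_has_sup u).
by move=> _ [n _ <-].
Qed.

Lemma c0_sup_ge0 u : 0 <= c0_sup u.
Proof. exact: le_trans (normc_ge0 _) (c0_sup_ge u 0). Qed.

Definition c0_norm (u : c0) : R[i] := (c0_sup u)%:C.

Lemma c0_normD u v : c0_norm (u + v) <= c0_norm u + c0_norm v.
Proof.
rewrite /c0_norm -rmorphD lecR; apply: c0_sup_le => n.
apply: le_trans (le_normcD (u n) (v n)) _.
by apply: lerD; exact: c0_sup_ge.
Qed.

Let c0_supZ_le a u : c0_sup (a *: u) <= normc a * c0_sup u.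
Proof.
apply: c0_sup_le => n; rewrite [X in normc X]/(a * u n) normcM.
by rewrite ler_wpM2l ?normc_ge0// c0_sup_ge.
Qed.

Lemma c0_normZ a u : c0_norm (a *: u) = `|a| * c0_norm u.
Proof.
rewrite /c0_norm normrE -rmorphM; congr (_%:C).
apply/eqP; rewrite eq_le c0_supZ_le /=.
have [->|a0] := eqVneq a 0; first by rewrite normc0 mul0r c0_sup_ge0.
have na : 0 < normc a.
  by rewrite lt_neqAle normc_ge0 andbT eq_sym; apply: contra a0 => /eqP/eq0_normc->.
rewrite -ler_pdivlMl//; have := c0_supZ_le a^-1 (a *: u).
by rewrite scalerA mulVf// scale1r normcV.
Qed.

Lemma c0_norm0_eq0 u : c0_norm u = 0 -> u = 0.
Proof.
case=> u0; apply: val_inj; apply/funext => n; apply: eq0_normc.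
by apply/eqP; rewrite eq_le normc_ge0 andbT -u0 c0_sup_ge.
Qed.

HB.instance Definition _ := Lmodule_isNormed.Build R[i] c0
  c0_normD c0_normZ c0_norm0_eq0.

End c0.

(* The subspace X of V contains c_0: c_0 is linearly homeomorphic to a closed
   subspace Y of X (Y, the range of T, is automatically a linear subspace). *)
Definition contains_c0 (R : realType) (V : normedModType R[i]) (X : set V) :=
  exists Y : set V, [/\ Y `<=` X, closed Y &
    exists (T : {linear c0 R -> V}) (S : V -> c0 R),
      [/\ range T = Y, continuous T, cancel T S & {within Y, continuous S}]].

(* P is a bounded linear projection of the subspace E onto its subspace F; the
   values of P outside of E are irrelevant. *)
Definition bounded_projection (R : realType) (V : normedModType R[i])
    (E F : set V) (P : V -> V) :=
  [/\ forall a x y, E x -> E y -> P (a *: x + y) = a *: P x + P y,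
      exists M : R, forall x, E x -> `|P x| <= M%:C * `|x|,
      F `<=` E,
      P @` E = F &
      forall y, F y -> P y = y].

(* G with its Borel sigma-algebra; measurable types are pointed, here by 0. *)
Definition borel (G : topologicalZmodType) : Type := G.

HB.instance Definition _ (G : topologicalZmodType) :=
  TopologicalZmodule.on (borel G).
HB.instance Definition _ (G : topologicalZmodType) := isPointed.Build (borel G) 0.
HB.instance Definition _ (G : topologicalZmodType) :=
  @isMeasurable.Build (sigma_display (@open G)) (borel G) <<s @open G >>
    (@sigma_algebra0 _ setT _) (@sigma_algebraC (borel G) _)
    (@sigma_algebra_bigcup _ setT _).

(* The normalized Haar measure of a compact abelian group: the regular,
   translation-invariant Borel probability measure. *)
Definition is_haar (R : realType) (G : topologicalZmodType)
    (m : probability (borel G) R) :=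
  forall A : set (borel G), measurable A ->
  [/\ forall g : G, m [set g + x | x in A] = m A,
      m A = ereal_inf [set m U | U in [set U | open U /\ A `<=` U]] &
      m A = ereal_sup [set m K | K in [set K | compact K /\ K `<=` A]]].

(* The dual group of G (as a set); G is written additively. *)
Record character (R : realType) (G : topologicalZmodType) := Character {
  character_fun :> G -> R[i] ;
  character_continuous : continuous character_fun ;
  character_norm1 : forall x, `|character_fun x| = 1 ;
  characterD : forall x y,
    character_fun (x + y) = character_fun x * character_fun y }.

Section spaces.
Context (R : realType) (G : topologicalZmodType) (m : probability (borel G) R).
Implicit Type Lambda : set (character R G).

Definition fourier (f : G -> R[i]) (gamma : character R G) : R[i] :=
  cintegral m (fun x : borel G => f x * (gamma x)^*%C).

Definition Linfty_spec Lambda : set (Linfty m) :=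
  [set f | forall gamma, ~ Lambda gamma -> fourier f gamma = 0].

(* The continuous functions, viewed inside L^oo. *)
Definition C_spec Lambda : set (Linfty m) :=
  [set f | exists g : G -> R[i], [/\ continuous g,
    {ae m, forall x, f x = g x} &
    forall gamma, ~ Lambda gamma -> fourier g gamma = 0]].

Definition riemann_integrable (h : G -> R[i]) :=
  (exists M : R, forall x, normc (h x) <= M) /\
  m.-negligible [set x : borel G | ~ {for (x : G), continuous h}].

End spaces.

Arguments Linfty_spec {R G} m Lambda.
Arguments C_spec {R G} m Lambda.

(* Main.v *)
Require Import Defs.
From mathcomp Require Import all_boot all_order all_algebra finmap.
From mathcomp Require Import all_classical all_reals all_analysis.
From mathcomp Require Import measurable_realfun ess_sup_inf.
From mathcomp Require Import complex.
From mathcomp Require Import lra ring zify.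
Import numFieldNormedType.Exports.

(* For x in G write tau_x for the translation by x and let Q = id - P, which kills C_Lambda.

   No c_0: a copy of c_0 in C_Lambda yields continuous functions F_n of spectrum in Lambda
   with sup_x sum |F_n(x)| finite and Re F_n(x_n) >= delta.  Every bounded real sequence b
   gives sum b_n F_n in L^oo_Lambda, and b |-> Q (sum b_n F_n) kills finite sequences.  Hence
   a bounded functional of it vanishes on the indicators of all but countably many members of
   an almost disjoint family, so for countably many functionals there is an infinite B on
   which all vanish: sum_(n in B) F_n and its image p under P, a continuous function, have the
   same averages over the neighbourhoods of x_n and of a cluster point x of (x_n).  For a
   sparse subsequence these averages differ by at least delta/2 when n is in B, which
   contradicts the continuity of p.

   Riemann-integrable functions: Riemann sums show that 1_E * f, for f in L^oo_Lambda almost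
   everywhere equal to a Riemann-integrable h, is a continuous function, of spectrum in Lambda,
   and, when E is a union of pieces of a fine partition that all meet a given set A, uniformly
   close to a combination of translates tau_t f with t in A.  Hence phi (Q (tau_t f)) = 0 for
   almost all t, for every bounded functional phi, and again countably many functionals can be
   treated at once: for every sequence of open sets there is a continuous p with the same
   integrals as f over them.  If h were not uniformly continuous on its set of continuity
   points, averages of f around points x_n, y_n getting close to each other would contradict
   the continuity of p.

   G need not be metrizable: "getting close" is modulo the subgroup K that is the intersection
   of a decreasing sequence of neighbourhoods of 0, and the averages are taken over
   K-invariant open sets. *)

Set Implicit Arguments.
Unset Strict Implicit.
Unset Printing Implicit Defensive.

Import Order.TTheory GRing.Theory Num.Theory.
Import Normc.
(* Num.Theory shadows normrE, ReM and ImM of Defs. *)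
Import Defs.

Local Open Scope classical_set_scope.
Local Open Scope complex_scope.
Local Open Scope ring_scope.
Local Open Scope quotient_scope.

(** * Essentially bounded functions *)

Lemma cvg_normr_le (R : realType) (u : nat -> R) (l B : R) :
  u n @[n --> \oo] --> l -> (forall n, `|u n| <= B) -> `|l| <= B.
Proof.
move=> ul uB; rewrite ler_norml; apply/andP; split.
- by apply: cvgr_to_ge ul _; apply: nearW => n; have := uB n; rewrite ler_norml => /andP[].
- by apply: cvgr_to_le ul _; apply: nearW => n; have := uB n; rewrite ler_norml => /andP[].
Qed.

Section essentially_bounded.
Context d (T : measurableType d) (R : realType) (mu : probability T R).
Implicit Types (D : set T) (r s : T -> R).

(* Variants of filterS that infer the filter from the measure: on [borel G] the
   predicates are often stated over the convertible type [G]. *)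
Lemma ae_imp (P Q : T -> Prop) : {ae mu, forall x, P x} -> (forall x, P x -> Q x) ->
  {ae mu, forall x, Q x}.
Proof. by move=> + PQ; apply: filterS. Qed.

Lemma ae_imp2 (P Q S : T -> Prop) : {ae mu, forall x, P x} -> {ae mu, forall x, Q x} ->
  (forall x, P x -> Q x -> S x) -> {ae mu, forall x, S x}.
Proof. by move=> + + PQ; apply: filterS2. Qed.

Definition ess_le (M : R) r :=
  measurable_fun [set: T] r /\ {ae mu, forall x, `|r x| <= M}.

Lemma ess_le_integrable M r D : measurable D -> ess_le M r ->
  mu.-integrable D (EFin \o r).
Proof.
move=> mD [mr rM]; apply/integrableP; split.
  exact/measurable_EFinP/measurable_funTS.
have mu1 : (mu D < +oo)%E by exact: le_lt_trans (probability_le1 mu mD) (ltry 1).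
apply: (@le_lt_trans _ _ (\int[mu]_(x in D) `|M|%:E)%E); last first.
  by rewrite integral_cst// lte_mul_pinfty.
apply: ae_ge0_le_integral => //.
- by apply: measurableT_comp => //; exact/measurable_EFinP/measurable_funTS.
- by apply: filterS rM => x rx _; rewrite /= lee_fin (le_trans rx)// ler_norm.
Qed.

Lemma fine_mu_ge0 D : 0 <= fine (mu D).
Proof. exact: fine_ge0. Qed.

Lemma fine_muK D : measurable D -> (fine (mu D))%:E = mu D.
Proof.
by move=> mD; rewrite fineK// ge0_fin_numE// (le_lt_trans (probability_le1 mu mD))// ltry.
Qed.

Lemma fine_mu_le1 D : measurable D -> fine (mu D) <= 1.
Proof. by move=> mD; rewrite -lee_fin fine_muK// probability_le1. Qed.

Lemma fine_mu_le A B : measurable A -> measurable B -> A `<=` B ->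
  fine (mu A) <= fine (mu B).
Proof.
move=> mA mB AB; rewrite -lee_fin !fine_muK//.
by apply: le_measure => //; exact/mem_set.
Qed.

Lemma fine_muD A B : measurable A -> measurable B -> B `<=` A ->
  fine (mu (A `\` B)) = fine (mu A) - fine (mu B).
Proof.
move=> mA mB BA; rewrite measureD//; last first.
  by apply: (le_lt_trans (probability_le1 mu mA)); rewrite ltry.
by rewrite setIidr// fineB//; exact: fin_num_measure.
Qed.

Lemma ae_eq_Rintegral r s D : measurable D ->
  measurable_fun [set: T] r -> measurable_fun [set: T] s ->
  {ae mu, forall x, D x -> r x = s x} ->
  \int[mu]_(x in D) r x = \int[mu]_(x in D) s x.
Proof.
move=> mD mr ms rs; congr fine; apply: ae_eq_integral => //.
- exact/measurable_EFinP/measurable_funTS.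
- exact/measurable_EFinP/measurable_funTS.
- by apply: filterS rs => x + Dx; move=> /(_ Dx) ->.
Qed.

Lemma ae_le_Rintegral r s D : measurable D ->
  mu.-integrable D (EFin \o r) -> mu.-integrable D (EFin \o s) ->
  {ae mu, forall x, D x -> r x <= s x} ->
  \int[mu]_(x in D) r x <= \int[mu]_(x in D) s x.
Proof.
move=> mD ir is_ rs; rewrite -subr_ge0 -RintegralB//.
have mr := measurable_int _ ir; have ms := measurable_int _ is_.
have msr : measurable_fun D (fun x => s x - r x).
  by apply: measurable_funB; exact/measurable_EFinP.
have -> : \int[mu]_(x in D) (s x - r x) = \int[mu]_(x in D) `|s x - r x|.
  congr fine; apply: ae_eq_integral => //.
  - exact/measurable_EFinP.
  - by apply/measurable_EFinP; exact: measurableT_comp.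
  - by apply: filterS rs => x + Dx; move=> /(_ Dx) rsx; rewrite ger0_norm// subr_ge0.
exact: Rintegral_ge0.
Qed.

Lemma ae_norm_Rintegral_le M r D : measurable D ->
  measurable_fun [set: T] r -> {ae mu, forall x, D x -> `|r x| <= M} ->
  `|\int[mu]_(x in D) r x| <= M * fine (mu D).
Proof.
move=> mD mr rM.
have ec a : ess_le `|a| (cst a) by split; [exact: measurable_cst|exact: nearW].
pose r' := fun x => if x \in D then r x else 0.
have er' : ess_le `|M| r'.
  split.
    rewrite (_ : r' = fun x => r x * \1_D x).
      by apply: measurable_funM => //; exact: measurable_indic.
    by apply/funext => x; rewrite /r' indicE; case: (x \in D); rewrite ?mulr1 ?mulr0.
  apply: filterS rM => x rx; rewrite /r'; case: ifPn => xD; last by rewrite normr0.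
  by apply: le_trans (ler_norm _); apply: rx; rewrite inE in xD.
have -> : \int[mu]_(x in D) r x = \int[mu]_(x in D) r' x.
  by apply: eq_Rintegral => x xD; rewrite /r' xD.
have nr' : {ae mu, forall x, D x -> `|r' x| <= M}.
  by apply: filterS rM => x rx Dx; rewrite /r' mem_set//; exact: rx.
have i1 a : mu.-integrable D (EFin \o cst a) by exact: (ess_le_integrable mD (ec a)).
have i2 := ess_le_integrable mD er'.
rewrite ler_norml; apply/andP; split.
- have := Rintegral_cst mu mD (- M); rewrite mulNr => <-.
  apply: ae_le_Rintegral => //; first exact: (i1 (- M)).
  by apply: filterS nr' => x /[apply]; rewrite ler_norml => /andP[].
- rewrite -(Rintegral_cst mu mD M).
  apply: ae_le_Rintegral => //; first exact: (i1 M).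
  by apply: filterS nr' => x /[apply]; rewrite ler_norml => /andP[].
Qed.

Lemma ess_leD M N r s : ess_le M r -> ess_le N s ->
  ess_le (M + N) (fun x => r x + s x).
Proof.
move=> [mr rM] [ms sN]; split; first exact: measurable_funD.
by apply: filterS2 rM sN => x rx sx; rewrite (le_trans (ler_normD _ _))// lerD.
Qed.

Lemma ess_leZ a M r : ess_le M r -> ess_le (`|a| * M) (fun x => a * r x).
Proof.
move=> [mr rM]; split; first by apply: measurable_funM => //; exact: measurable_cst.
by apply: filterS rM => x rx; rewrite normrM ler_wpM2l.
Qed.

Lemma ess_leM M N r s : ess_le M r -> ess_le N s ->
  ess_le (M * N) (fun x => r x * s x).
Proof.
move=> [mr rM] [ms sN]; split; first exact: measurable_funM.
by apply: filterS2 rM sN => x rx sx; rewrite normrM ler_pM.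
Qed.

Lemma ess_leN M r : ess_le M r -> ess_le M (fun x => - r x).
Proof.
move=> [mr rM]; split; first exact: measurableT_comp.
by apply: filterS rM => x; rewrite normrN.
Qed.

Lemma ess_leB M N r s : ess_le M r -> ess_le N s ->
  ess_le (M + N) (fun x => r x - s x).
Proof. by move=> rM sN; exact: ess_leD rM (ess_leN sN). Qed.

Lemma Rintegral_bounded_cvg M (r_ : nat -> T -> R) r D : measurable D ->
  (forall n, measurable_fun [set: T] (r_ n)) ->
  (forall n x, `|r_ n x| <= M) -> (forall x, r_ n x @[n --> \oo] --> r x) ->
  \int[mu]_(x in D) r_ n x @[n --> \oo] --> \int[mu]_(x in D) r x.
Proof.
move=> mD mr_ r_M r_r.
have mr : measurable_fun [set: T] r.
  by apply: (measurable_fun_cvg mr_) => x _; exact: r_r.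
have er_ n : ess_le M (r_ n) by split => //; exact: nearW (r_M n).
have er : ess_le M r.
  by split => //; apply: nearW => x; exact: cvg_normr_le (r_r x) (fun n => r_M n x).
have [] := @dominated_convergence _ _ _ mu D mD (fun n => EFin \o r_ n) (EFin \o r)
  (cst M%:E).
- by move=> n; exact/measurable_EFinP/measurable_funTS.
- exact/measurable_EFinP/measurable_funTS.
- by apply: nearW => x Dx; apply: cvg_EFin; [exact: nearW|exact: r_r].
- apply: (@ess_le_integrable `|M| (cst M)) => //.
  by split; [exact: measurable_cst|exact: nearW].
- by apply: nearW => x n Dx; rewrite /= lee_fin.
move=> ir _ rr; apply: fine_cvg.
by rewrite fineK//; exact: integrable_fin_num.
Qed.

End essentially_bounded.

(** * Topological abelian groups *)

Section complex_valued.
Variables (R : realType) (T : topologicalType).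
Implicit Types (z w : R[i]) (h : T -> R[i]).

Lemma normc_Re z : `|complex.Re z| <= normc z.
Proof.
by case: z => a b /=; rewrite -sqrtr_sqr ler_wsqrtr// lerDl sqr_ge0.
Qed.

Lemma normc_Im z : `|complex.Im z| <= normc z.
Proof.
by case: z => a b /=; rewrite -sqrtr_sqr ler_wsqrtr// lerDr sqr_ge0.
Qed.

Lemma normc_le_ReIm z : normc z <= `|complex.Re z| + `|complex.Im z|.
Proof.
case: z => a b /=; rewrite -[leRHS]ger0_norm ?addr_ge0// -sqrtr_sqr ler_wsqrtr//.
by rewrite sqrrD -[a ^+ 2]real_normK ?num_real// -[b ^+ 2]real_normK ?num_real//
  lerD2r lerDl mulrn_wge0// mulr_ge0.
Qed.

Lemma ReB z w : complex.Re (z - w) = complex.Re z - complex.Re w.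
Proof. by case: z; case: w. Qed.

Lemma ImB z w : complex.Im (z - w) = complex.Im z - complex.Im w.
Proof. by case: z; case: w. Qed.

Lemma norm_lt_normc z (e : R) : (`|z| : R[i]) < e%:C <-> normc z < e.
Proof. by rewrite Defs.normrE ltcR. Qed.

Lemma continuous_normcP h x : {for x, continuous h} <->
  forall e : R, 0 < e -> \forall y \near x, normc (h x - h y) < e.
Proof.
split=> [hx e e0|hx].
  have e0' : 0 < e%:C by rewrite ltcR.
  have /cvgrPdist_lt/(_ _ e0') : h y @[y --> x] --> h x by exact: hx.
  by apply: filterS => y hxy; apply/norm_lt_normc; exact: hxy.
apply/cvgrPdist_lt => e e0.
have e0' : 0 < complex.Re e by move: e0; case: e => a b; rewrite ltcE /= => /andP[].
have e'E : (complex.Re e)%:C = e.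
  by move: e0; case: e {e0'} => a b; rewrite ltcE /= => /andP[/eqP ->].
have := hx _ e0'; apply: filterS => y /norm_lt_normc; rewrite e'E; exact.
Qed.

Lemma continuous_ReIm h x : {for x, continuous h} <->
  {for x, continuous (fun y => complex.Re (h y) : R^o)} /\
  {for x, continuous (fun y => complex.Im (h y) : R^o)}.
Proof.
rewrite continuous_normcP; split=> [hx|[hRe hIm] e e0].
  split; apply/cvgrPdist_lt => e /hx; apply: filterS => y; apply: le_lt_trans.
    by rewrite -ReB normc_Re.
  by rewrite -ImB normc_Im.
have e2 : 0 < e / 2 by rewrite divr_gt0.
move/cvgrPdist_lt : hRe => /(_ _ e2) hRe.
move/cvgrPdist_lt : hIm => /(_ _ e2); move: hRe.
apply: filterS2 => y yR yI; apply: le_lt_trans (normc_le_ReIm _) _.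
by rewrite ReB ImB [ltRHS]splitr ltrD.
Qed.

End complex_valued.

Section topological_group.
Variable G : topologicalZmodType.
Implicit Types (x y z : G) (U V W A : set G).

Lemma addl_continuous x : continuous (fun y : G => x + y).
Proof.
move=> y; apply: (@continuous_comp _ _ _ (fun y => (x, y)) (fun z : G * G => z.1 + z.2)).
  by apply: cvg_pair => /=; [exact: cvg_cst|exact: cvg_id].
exact: add_continuous.
Qed.

Lemma nbhs_addl x A : nbhs x A <-> nbhs 0 [set v | A (x + v)].
Proof.
split=> xA.
  by apply: (@addl_continuous x 0); rewrite /= addr0.
have : nbhs (- x + x) [set v | A (x + v)] by rewrite addNr.
move=> h; have {}h : nbhs x [set y | A (x + (- x + y))] := @addl_continuous (- x) x _ h.
by apply: filterS h => y /=; rewrite addrA subrr add0r.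
Qed.

Lemma nbhs0_add_sub A : nbhs (0 : G) A ->
  exists W, [/\ open W, W 0, forall v, W v -> W (- v) &
    forall v w, W v -> W w -> A (v + w)].
Proof.
move=> A0.
have : nbhs ((0 : G), (0 : G)) [set p : G * G | A (p.1 + p.2)].
  by apply: (@add_continuous G (0, 0)); rewrite /= addr0.
case=> -[/= B C] [B0 C0] BCA.
have N0 : nbhs (0 : G) [set v | (B `&` C) (- v)].
  by apply: (@opp_continuous G 0); rewrite oppr0; exact: filterI.
have : nbhs (0 : G) (B `&` C `&` [set v | (B `&` C) (- v)]).
  by apply: filterI => //; exact: filterI.
rewrite nbhsE => -[W [oW W0] WBC].
exists (W `&` [set v | W (- v)]); split.
- by apply: openI => //; exact: (continuousP _).1 (@opp_continuous G) _ oW.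
- by split => //=; rewrite oppr0.
- by move=> v [/= Wv Wv']; split => //=; rewrite opprK.
- by move=> v w [/WBC[[Bv _] _] _] [/WBC[[_ Cw] _] _]; exact: (BCA (v, w)).
Qed.

Lemma open_addl x U : open U -> open [set v | U (x + v)].
Proof. by move=> oU; exact: (continuousP _).1 (@addl_continuous x) _ oU. Qed.

Lemma closure_sub_add W A : open W -> W 0 -> (forall v, W v -> W (- v)) ->
  (forall v w, W v -> W w -> A (v + w)) -> closure W `<=` A.
Proof.
move=> oW W0 WN WA z Wz.
have : nbhs z [set y | W (- z + y)].
  by apply: open_nbhs_nbhs; split; [exact: open_addl|rewrite /= addNr].
move=> /Wz[v [/= Wv Wzv]].
have -> : z = v + - (- z + v) by rewrite opprD opprK addrCA subrr addr0.
by apply: WA => //; exact: WN.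
Qed.

Lemma compact_nbhs0_add A U : compact A -> open U -> A `<=` U ->
  \forall v \near (0 : G), forall x, A x -> U (x + v).
Proof.
move=> /compact_near_coveringP cA oU AU.
apply: (cA G (nbhs (0 : G)) (fun v x => U (x + v))) => x /AU Ux.
have : nbhs (x + 0) U by rewrite addr0; exact: open_nbhs_nbhs.
by move=> /(@add_continuous G (x, 0)).
Qed.

Lemma compact_unif_continuous (R : realType) A (h : G -> R[i]) e : compact A ->
  (forall x, A x -> {for x, continuous h}) -> 0 < e ->
  \forall v \near (0 : G), forall x, A x -> normc (h x - h (x + v)) <= e.
Proof.
move=> /compact_near_coveringP cA hA e0.
apply: (cA G (nbhs (0 : G)) (fun v x => normc (h x - h (x + v)) <= e)) => x Ax.
have e2 : 0 < e / 2 by rewrite divr_gt0.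
have hx := (continuous_normcP _ _).1 (hA x Ax) _ e2.
have : nbhs (x, 0) [set p : G * G | normc (h x - h (p.1 + p.2)) < e / 2].
  have {}hx : nbhs (x + 0) [set y | normc (h x - h y) < e / 2] by rewrite addr0.
  exact: (@add_continuous G (x, 0) _ hx).
have : nbhs (x, (0 : G)) [set p : G * G | normc (h x - h p.1) < e / 2].
  exact: (@cvg_fst _ _ (nbhs x) (nbhs (0 : G)) _ _ hx).
apply: filterS2 => -[y v] /= h1 h2.
have -> : h y - h (y + v) = (h x - h (y + v)) - (h x - h y).
  by rewrite opprB [RHS]addrC addrA subrK.
apply: ltW; rewrite (le_lt_trans (le_normcD _ _))// normcN [ltRHS]splitr ltrD//.
Qed.

End topological_group.

(** * Haar measure *)

Section borel.
Variables (R : realType) (G : topologicalZmodType).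

Lemma borel_open (U : set (borel G)) : open (U : set G) -> measurable U.
Proof. exact: sub_sigma_algebra. Qed.

Lemma borel_continuous (r : G -> R) : continuous r ->
  measurable_fun [set: borel G] (r : borel G -> R).
Proof.
move=> cr; apply: (measurability _ (RGenOpens.measurableE R)) => _ [_ [a [b ->] <-]].
rewrite setTI; apply: borel_open.
exact: (continuousP _).1 cr _ (interval_open _ _).
Qed.

Lemma cmeasurable_continuous (g : G -> R[i]) : continuous g ->
  cmeasurable (g : borel G -> R[i]).
Proof.
move=> cg; split; apply: borel_continuous => x.
  by have [] := (continuous_ReIm _ _).1 (cg x).
by have [] := (continuous_ReIm _ _).1 (cg x).
Qed.

Lemma borel_addl (x : G) : measurable_fun [set: borel G] (fun y : borel G => x + y : borel G).
Proof.
apply: (@measurability _ _ (borel G) (borel G) setT _ (@open G)) => //.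
move=> _ [U oU <-]; rewrite setTI; apply: borel_open; exact: (open_addl x oU).
Qed.

Lemma borel_addl_set (x : G) (A : set (borel G)) : measurable A ->
  measurable ([set v | A (x + v)] : set (borel G)).
Proof. by move=> mA; rewrite -[X in measurable X]setTI; exact: borel_addl. Qed.

End borel.

Lemma compact_normc_bounded (R : realType) (T : topologicalType) (h : T -> R[i]) :
  compact [set: T] -> continuous h -> exists M, forall x, normc (h x) <= M.
Proof.
move=> /compact_near_coveringP cT ch.
have : \forall n \near \oo, forall x, [set: T] x -> normc (h x) <= n%:R.
  apply: (cT nat \oo (fun n x => normc (h x) <= n%:R)) => x _.
  have [N Nx] : exists N, normc (h x) + 1 <= N%:R.
    exists (Num.bound (normc (h x) + 1)); apply: ltW; apply: archi_boundP.
    by rewrite addr_ge0// normc_ge0.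
  have := (continuous_normcP _ _).1 (ch x) 1 ltr01.
  move=> hx; exists ([set y | normc (h x - h y) < 1], [set n | (N <= n)%N]).
    by split => //=; exists N.
  move=> [y n] /= [hxy Nn]; apply: (@le_trans _ _ N%:R); last by rewrite ler_nat.
  apply: le_trans Nx; have -> : h y = h x - (h x - h y) by rewrite opprB addrC subrK.
  by rewrite (le_trans (le_normcD _ _))// lerD2l normcN ltW.
by move=> [N _ /(_ N (leqnn N)) hN]; exists N%:R => x; exact: hN.
Qed.

Section haar.
Variables (R : realType) (G : topologicalZmodType).
Hypothesis G_compact : compact [set: G].
Hypothesis G_hausdorff : hausdorff_space G.
Variable m : probability (borel G) R.
Hypothesis m_haar : is_haar m.
Implicit Types (x y z : G) (A D K U V : set G) (r : G -> R).

Lemma haar_addl x (A : set (borel G)) : measurable A -> m [set v | A (x + v)] = m A.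
Proof.
move=> mA; have [/(_ (- x)) <- _ _] := m_haar mA; congr (m _).
apply/seteqP; split=> v /=.
  by move=> Axv; exists (x + v) => //; rewrite addrA addNr add0r.
by move=> [a Aa <-]; rewrite addrA subrr add0r.
Qed.

Lemma ae_addl x (P : G -> Prop) : {ae m, forall v, P v} ->
  {ae m, forall v : borel G, P (x + v)}.
Proof.
move=> [N [mN N0 PN]]; exists [set v | N (x + v)]; split.
- exact: borel_addl_set.
- by rewrite haar_addl.
- by move=> v /= Pv; apply: PN.
Qed.

Lemma ess_le_addl M x r : ess_le m M (r : borel G -> R) ->
  ess_le m M (fun v : borel G => r (x + v)).
Proof.
move=> [mr rM]; split; last exact: ae_addl rM.
exact: (measurableT_comp mr (borel_addl x)).
Qed.

Lemma Rintegral_addl M x (D : set (borel G)) r : measurable D ->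
  ess_le m M (r : borel G -> R) ->
  \int[m]_(y in D) r y = \int[m]_(v in [set v : borel G | D (x + v)]) r (x + v).
Proof.
move=> mD rM; congr fine.
have := @integral_pushforward _ _ (borel G) (borel G) R (fun v => x + v) (borel_addl x) m D
  (EFin \o r).
rewrite /comp /= => <- //.
- apply: eq_measure_integral; first exact: borel_addl.
  by move=> ? A mA _; exact: esym (haar_addl x mA).
- by apply/measurable_EFinP; case: rM.
- apply: (ess_le_integrable (M := M)); first exact: borel_addl_set.
  exact: ess_le_addl.
Qed.

Definition shift_set A (a : G) : set (borel G) := [set z | A (- a + z)].

Lemma Rintegral_shift_set M A a r : open A -> ess_le m M (r : borel G -> R) ->
  \int[m]_(z in shift_set A a) r z = \int[m]_(u in A) r (a + u).
Proof.
move=> oA rM; have mA : measurable (A : set (borel G)) by exact: borel_open.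
rewrite (Rintegral_addl a (borel_addl_set (- a) mA) rM).
by congr Rintegral; apply/seteqP; split=> u; rewrite /= addKr.
Qed.

Lemma Rintegral_addl_near_cst M A a c e r : open A -> ess_le m M (r : borel G -> R) ->
  {ae m, forall u, A u -> `|c - r (a + u)| <= e} ->
  `|c * fine (m A) - \int[m]_(u in A) r (a + u)| <= e * fine (m A).
Proof.
move=> oA rM rc; have mA : measurable (A : set (borel G)) by exact: borel_open.
have ra := ess_le_addl a rM.
have cc : ess_le m `|c| (cst c : borel G -> R).
  by split; [exact: measurable_cst|exact: nearW].
rewrite -(Rintegral_cst m mA) -RintegralB//; last 2 first.
- exact: ess_le_integrable cc.
- exact: ess_le_integrable ra.
by apply: ae_norm_Rintegral_le => //; have [] := ess_leB cc ra.
Qed.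

Lemma translate_cover V : open V -> V 0 ->
  exists s : seq G, forall y, exists2 x, x \in s & V (y - x).
Proof.
move=> oV V0; have : compact [set: borel G] by exact: G_compact.
rewrite compact_cover => /(_ G setT (fun x => [set y | V (- x + y)])).
case.
- by move=> x _; exact: open_addl.
- by move=> y _; exists y => //=; rewrite addNr.
- move=> s _ cs; exists (enum_fset s) => y; have [x xs Vy] := cs y I.
  by exists x => //; rewrite addrC.
Qed.

Lemma haar_open_gt0 U : open U -> U !=set0 -> 0 < fine (m U).
Proof.
move=> oU [a Ua]; have mU : measurable (U : set (borel G)) by exact: borel_open.
rewrite lt_neqAle fine_ge0// andbT eq_sym; apply/negP => /eqP U0.
have {}U0 : m U = 0%E by rewrite -(fine_muK m mU) U0.
have Ua0 : U (a + 0) by rewrite addr0.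
have [s cs] := translate_cover (open_addl a oU) Ua0.
pose F n : set (borel G) := [set y | U (a - nth 0 s n + y)].
have F0 n : m (F n) = 0%E by rewrite /F haar_addl.
have mF n : measurable (F n) by exact: borel_addl_set.
have : m.-negligible (\bigcup_n F n).
  by apply: negligible_bigcup => n; exact: (negligibleP m (mF n)).2 (F0 n).
have -> : \bigcup_n F n = setT.
  apply/seteqP; split=> // y _; have [x xs Uy] := cs y.
  by exists (index x s) => //; rewrite /F /= nth_index// addrAC -addrA.
move=> /(negligibleP _ measurableT) m0; have := probability_setT m.
by rewrite [X in X = _]m0 => /esym/eqP; rewrite onee_eq0.
Qed.


Lemma borel_compact K : compact K -> measurable (K : set (borel G)).
Proof.
move=> cK; rewrite -[K]setCK; apply: measurableC; apply: borel_open.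
by apply: closed_openC; exact: compact_closed.
Qed.

Lemma haar_open_addl U e : open U -> 0 < e ->
  \forall v \near (0 : G), fine (m (U `\` [set y | U (v + y)])) <= e.
Proof.
move=> oU e0; have mU : measurable (U : set (borel G)) by exact: borel_open.
have [_ _ mUE] := m_haar mU.
have : (m U - e%:E < m U)%E.
  by rewrite -(fine_muK m mU) -EFinB lte_fin ltrBlDr ltrDl.
rewrite [X in (_ < X)%E]mUE => /ereal_sup_gt[_ [K [cK KU] <-] mK].
have := compact_nbhs0_add cK oU KU; apply: filterS => v KUv.
have mV : measurable ([set y | U (v + y)] : set (borel G)) by exact: borel_addl_set.
have mcK : measurable (K : set (borel G)) by exact: borel_compact.
have le1 : fine (m (U `\` [set y | U (v + y)])) <= fine (m (U `\` K)).
  apply: fine_mu_le; [exact: measurableD|exact: measurableD|].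
  by move=> y [Uy nUy]; split=> // Ky; apply: nUy; rewrite /= addrC; exact: KUv.
apply: le_trans le1 _; rewrite (fine_muD m mU mcK KU).
have lt1 : ((fine (m U) - e)%:E < (fine (m K))%:E)%E.
  by rewrite EFinB (fine_muK m mU) (fine_muK m mcK).
by rewrite lte_fin in lt1; lra.
Qed.


Lemma averages_merge (p : G -> R[i]) (V U : nat -> set G) (x y : nat -> G)
    (B : set nat) e : continuous p ->
  (forall i, closure (V i.+1) `<=` V i) -> (forall i, V i (x i - y i)) ->
  (forall i, open (U i)) ->
  (forall i z, (forall j, V j z) -> [set u | U i (z + u)] = U i) ->
  (forall N, exists2 i, (N <= i)%N & B i) -> 0 < e ->
  exists2 i, B i & `|\int[m]_(u in U i) complex.Re (p (x i + u)) -
                    \int[m]_(u in U i) complex.Re (p (y i + u))| <= e * fine (m (U i)).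
Proof.
move=> cp Vcl Vxy oU UV Binf e0.
have /choice[b bB] : forall N, exists i, (N <= i)%N /\ B i.
  by move=> N; have [i Ni Bi] := Binf N; exists i.
pose d N := x (b N) - y (b N).
have Vle i j : (i <= j)%N -> V j `<=` V i.
  elim: j => [|j IH]; first by rewrite leqn0 => /eqP ->.
  rewrite leq_eqVlt => /orP[/eqP->//|/IH Vji].
  by apply: subset_trans Vji; apply: subset_trans (Vcl j); exact: subset_closure.
have [z [_ zd]] : [set: G] `&` cluster (d @ \oo) !=set0.
  by apply: G_compact; exact: filterT.
have Vz j : V j z.
  apply: Vcl => A /zd; apply.
  exists j.+1 => // N /= jN; apply: (Vle _ (b N)) => //.
  exact: leq_trans jN (bB N).1.
have := compact_unif_continuous G_compact (fun x _ => cp x) e0.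
move=> pe; have : nbhs z [set y | forall x, setT x -> normc (p x - p (x + (- z + y))) <= e].
  by apply/nbhs_addl; apply: filterS pe => v /= pv a _; rewrite addKr; exact: pv.
move=> /(zd (range d)) [|_ [[N _ <-] pN]].
  by exists 0%N => // N _; exists N.
exists (b N); first exact: (bB N).2.
have mU : measurable (U (b N) : set (borel G)) by exact: borel_open.
have [M pM] := compact_normc_bounded G_compact cp.
have eRe w : ess_le m M (fun u : borel G => complex.Re (p (w + u))).
  apply: (ess_le_addl w (r := fun y => complex.Re (p y))); split.
    by have [] := cmeasurable_continuous cp.
  by apply: nearW => u; apply: le_trans (pM u); exact: normc_Re.
have -> : \int[m]_(u in U (b N)) complex.Re (p (y (b N) + u)) =
    \int[m]_(u in U (b N)) complex.Re (p (y (b N) + (z + u))).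
  by rewrite (Rintegral_addl z mU (eRe (y (b N)))); congr Rintegral; rewrite UV.
have eRz := ess_le_addl z (eRe (y (b N))).
rewrite -RintegralB//; [|exact: ess_le_integrable (eRe _)|exact: ess_le_integrable eRz].
apply: ae_norm_Rintegral_le => //.
  by have [] := ess_leB (eRe (x (b N))) eRz.
apply: nearW => u Uu; rewrite -ReB; apply: le_trans (normc_Re _) _.
rewrite -normcN opprB; have := pN (y (b N) + (z + u)) I.
rewrite -addrA (addrA (z + u)) (addrAC z u) subrr add0r addrC -addrA subrK.
by rewrite (addrC u).
Qed.

Lemma Rintegral_setID (A B : set (borel G)) r : measurable A -> measurable B ->
  m.-integrable A (EFin \o r) ->
  \int[m]_(y in A) r y = \int[m]_(y in A `&` B) r y + \int[m]_(y in A `\` B) r y.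
Proof.
move=> mA mB iA; rewrite -[in LHS](setUIDK A B) Rintegral_setU//.
- exact: measurableI.
- exact: measurableD.
- by rewrite setUIDK.
- by apply/disj_set2P; rewrite setDE setIACA setICr setI0.
Qed.

Lemma Rintegral_open_addl U M e : open U -> 0 <= M -> 0 < e ->
  \forall v \near (0 : G), forall s (q : G -> R), ess_le m M (q : borel G -> R) ->
  `|\int[m]_(y in [set y : borel G | U (s + y)]) q y -
    \int[m]_(y in [set y : borel G | U (s + v + y)]) q y| <= 2 * e * M.
Proof.
move=> oU M0 e0; have nearU := haar_open_addl oU e0.
have nearNU : \forall v \near (0 : G), fine (m (U `\` [set y | U (- v + y)])) <= e.
  have : nbhs (- (0 : G)) [set v | fine (m (U `\` [set y | U (v + y)])) <= e] by rewrite oppr0.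
  by move=> h; exact: (@opp_continuous G 0 _ h).
apply: filterS2 nearU nearNU => v le1 le2 s q qM.
have mU : measurable (U : set (borel G)) by exact: borel_open.
have mUx x : measurable ([set y | U (x + y)] : set (borel G)) by exact: borel_addl_set.
pose q' y := q (- s + y); have q'M : ess_le m M (q' : borel G -> R) by exact: ess_le_addl.
have E x : \int[m]_(y in [set y : borel G | U (s + x + y)]) q y =
    \int[m]_(y in [set y : borel G | U (x + y)]) q' y.
  rewrite (Rintegral_addl s (mUx x) q'M); congr Rintegral.
    by apply/seteqP; split=> y /=; rewrite addrCA addrA.
  by apply/funext => y; rewrite /q' addrA addNr add0r.
have := E 0; rewrite addr0 => ->; rewrite E.
under [X in Rintegral _ X _]eq_set do rewrite add0r.
have iU : m.-integrable (U : set (borel G)) (EFin \o q') by exact: ess_le_integrable q'M.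
have iV : m.-integrable ([set y | U (v + y)] : set (borel G)) (EFin \o q').
  exact: ess_le_integrable q'M.
rewrite (Rintegral_setID mU (mUx v) iU) (Rintegral_setID (mUx v) mU iV).
rewrite [X in _ - (Rintegral _ X _ + _)]setIC opprD addrACA subrr add0r.
apply: le_trans (ler_normB _ _) _; rewrite -mulrA mulr_natl mulr2n; apply: lerD.
  apply: le_trans (ae_norm_Rintegral_le (M := M) _ _ _) _.
  - exact: measurableD.
  - by case: q'M.
  - by case: q'M => _; apply: filterS.
  by rewrite mulrC ler_wpM2r.
apply: le_trans (ae_norm_Rintegral_le (M := M) _ _ _) _.
- exact: measurableD.
- by case: q'M.
- by case: q'M => _; apply: filterS.
rewrite mulrC ler_wpM2r//; apply: le_trans le2.
have mD : measurable (U `\` [set y | U (- v + y)] : set (borel G)) by exact: measurableD.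
rewrite -(haar_addl v mD) le_eqVlt; apply/orP; left; apply/eqP; congr (fine (m _)).
by apply/seteqP; split=> y /=; rewrite addKr.
Qed.

End haar.

(** * Riemann sums *)

Section nbhs_chains.
Variable G : topologicalZmodType.
Implicit Types V : nat -> set G.

Definition nbhs_chain V :=
  (forall i, [/\ open (V i), V i 0 & forall v, V i v -> V i (- v)]) /\
  (forall i v w, V i.+1 v -> V i.+1 w -> V i (v + w)).

Lemma nbhs_chain_ex (A : nat -> set G -> set G) :
  (forall n W, nbhs 0 W -> nbhs 0 (A n W)) ->
  exists V, nbhs_chain V /\
    forall n v w, V n.+1 v -> V n.+1 w -> A n (V n) (v + w).
Proof.
move=> A0.
have /choice[F FP] : forall p : nat * set G, exists W, nbhs 0 p.2 ->
    [/\ open W, W 0, forall v, W v -> W (- v) &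
      forall v w, W v -> W w -> (p.2 `&` A p.1 p.2) (v + w)].
  move=> [n B] /=; have [B0|nB0] := pselect (nbhs 0 B); last by exists set0.
  by have [W ?] := nbhs0_add_sub (filterI B0 (A0 n B B0)); exists W.
pose V := fix V n := if n is k.+1 then F (k, V k) else [set: G].
have VP n : [/\ open (V n), V n 0 & forall v, V n v -> V n (- v)].
  elim: n => [|n [oV V0 _]]; first by split => //; exact: openT.
  have Vn : nbhs 0 (V n) by exact: open_nbhs_nbhs.
  by have [? ? ? _] := FP (n, V n) Vn.
have VV n v w : V n.+1 v -> V n.+1 w -> (V n `&` A n (V n)) (v + w).
  have [oV V0 _] := VP n; have Vn : nbhs 0 (V n) by exact: open_nbhs_nbhs.
  by have [_ _ _] := FP (n, V n) Vn; exact.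
exists V; split; first by split => // n v w vn wn; have [] := VV n v w vn wn.
by move=> n v w vn wn; have [] := VV n v w vn wn.
Qed.

Variable V : nat -> set G.
Hypothesis Vchain : nbhs_chain V.

Lemma nbhs_chainS i : V i.+1 `<=` V i.
Proof. by move=> v Vv; rewrite -[v]addr0; apply: Vchain.2 => //; case: (Vchain.1 i.+1). Qed.

Lemma nbhs_chain_le i j : (i <= j)%N -> V j `<=` V i.
Proof.
elim: j => [|j IH]; first by rewrite leqn0 => /eqP ->.
rewrite leq_eqVlt => /orP[/eqP->//|/IH Vji].
by apply: subset_trans Vji; exact: nbhs_chainS.
Qed.

Lemma nbhs_chain_closure i : closure (V i.+1) `<=` V i.
Proof. by have [oV V0 VN] := Vchain.1 i.+1; apply: closure_sub_add => //; exact: Vchain.2. Qed.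

(* V_(i+1) + K, where the subgroup K is the intersection of the chain.  Averages over these
   sets do not see translations by K: this replaces passing to the metrizable group G / K. *)
Definition core_nbhs i := [set u | exists2 z, forall j, V j z & V i.+1 (u - z)].

Lemma open_core_nbhs i : open (core_nbhs i).
Proof.
rewrite (_ : core_nbhs i = \bigcup_(z in [set z | forall j, V j z])
    [set u | V i.+1 (- z + u)]).
  by apply: bigcup_open => z _; apply: open_addl; case: (Vchain.1 i.+1).
by apply/seteqP; split=> [u [z Kz Vz]|u [z Kz Vz]]; exists z => //=; rewrite addrC.
Qed.

Lemma core_nbhs0 i : core_nbhs i 0.
Proof. by exists 0 => [j|]; rewrite ?subr0; [case: (Vchain.1 j)|case: (Vchain.1 i.+1)]. Qed.

Lemma core_nbhs_addl i z : (forall j, V j z) -> [set u | core_nbhs i (z + u)] = core_nbhs i.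
Proof.
have coreB v w : (forall j, V j v) -> (forall j, V j w) -> forall j, V j (v - w).
  by move=> Vv Vw j; apply: Vchain.2 => //; case: (Vchain.1 j.+1) => _ _; exact.
move=> Vz; apply/seteqP; split=> u [w Vw Vu].
  exists (w - z); first exact: coreB.
  by rewrite opprB addrA (addrC u).
exists (w + z); last by rewrite (addrC z u) (addrC w z) addrKA.
rewrite -[z]opprK; apply: coreB => // j.
by case: (Vchain.1 j) => _ _; exact.
Qed.

Lemma core_nbhs_sub_add i A : (forall v w, V i.+1 v -> V i.+1 w -> A (v + w)) ->
  core_nbhs i `<=` A.
Proof. by move=> VA u [z Vz Vu]; rewrite -(subrK z u); exact: VA. Qed.

End nbhs_chains.

Section step_functions.
Context d (T : measurableType d) (R : realType) (mu : probability T R).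
Variables (N : T -> nat) (n : nat) (c : nat -> R).
Hypothesis mN : forall i, measurable [set x | N x = i].
Hypothesis Nn : forall x, (N x < n)%N.

Let step_sum k x : R := \sum_(i < k) c i * \1_[set y | N y = i] x.

Let stepE x : c (N x) = step_sum n x.
Proof.
rewrite /step_sum (bigD1 (Ordinal (Nn x)))//= indicE mem_set// mulr1 big1 ?addr0// => i iN.
rewrite indicE memNset ?mulr0// => /= Nxi; move/negP : iN; apply; apply/eqP.
by apply: val_inj; rewrite /= Nxi.
Qed.

Let step_sum_ess_le k : ess_le mu (\sum_(i < k) `|c i|) (step_sum k).
Proof.
elim: k => [|k [mk bk]].
  rewrite /step_sum big_ord0 (_ : (fun _ => _) = cst 0); last first.
    by apply/funext => x; rewrite big_ord0.
  by split; [exact: measurable_cst|apply: nearW => x; rewrite normr0].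
have e1 : ess_le mu 1 (\1_[set y | N y = k] : T -> R).
  split; first exact: measurable_indic.
  by apply: nearW => x; rewrite indicE ger0_norm ?ler0n// lern1 leq_b1.
have := ess_leD (conj mk bk) (ess_leZ (c k) e1); rewrite mulr1 big_ord_recr/=.
by rewrite (_ : step_sum k.+1 = fun x => step_sum k x + c k * \1_[set y | N y = k] x)//;
  apply/funext => x; rewrite /step_sum big_ord_recr.
Qed.

Lemma step_ess_le : exists M, ess_le mu M (c \o N).
Proof.
exists (\sum_(i < n) `|c i|); rewrite (_ : c \o N = step_sum n)//.
by apply/funext => x /=; rewrite stepE.
Qed.

Lemma Rintegral_step E : measurable E ->
  \int[mu]_(x in E) c (N x) = \sum_(i < n) fine (mu (E `&` [set y | N y = i])) * c i.
Proof.
move=> mE; under eq_Rintegral do rewrite stepE.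
elim: n => [|k IH]; first by rewrite /step_sum; under eq_Rintegral do rewrite big_ord0;
  rewrite Rintegral_cst// mul0r big_ord0.
have ik := ess_le_integrable mE (step_sum_ess_le k).
have e1 : ess_le mu 1 (\1_[set y | N y = k] : T -> R).
  split; first exact: measurable_indic.
  by apply: nearW => x; rewrite indicE ger0_norm ?ler0n// lern1 leq_b1.
rewrite big_ord_recr/= -IH.
rewrite (_ : (fun x => step_sum k.+1 x) =
    fun x => step_sum k x + c k * \1_[set y | N y = k] x); last first.
  by apply/funext => x; rewrite /step_sum big_ord_recr.
rewrite RintegralD//; last exact: ess_le_integrable (ess_leZ (c k) e1).
congr (_ + _); rewrite RintegralZl//; last exact: ess_le_integrable e1.
rewrite mulrC; congr (_ * _); rewrite /Rintegral integral_indic//.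
by rewrite setIC.
Qed.

End step_functions.

Section riemann_sums.
Variables (R : realType) (G : topologicalZmodType).
Hypothesis G_compact : compact [set: G].
Variable m : probability (borel G) R.
Hypothesis m_haar : is_haar m.

Lemma fine_partition (W : set G) : nbhs 0 W -> exists (n : nat) (N : G -> nat),
  [/\ forall i, measurable ([set x | N x = i] : set (borel G)),
      forall x, (N x < n)%N & forall x y, N x = N y -> W (y - x)].
Proof.
move=> /nbhs0_add_sub[V [oV V0 VN VW]].
have [s cs] := translate_cover G_compact oV V0.
exists (size s), (fun y => find (fun x => `[< V (y - x) >]) s); split.
- elim: s {cs} => [|a s IH] i.
    case: i => [|i].
      by rewrite (_ : [set _ | _] = setT)//; apply/seteqP; split.
    by rewrite (_ : [set _ | _] = set0)//; apply/seteqP; split.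
  have mV : measurable ([set y | V (- a + y)] : set (borel G)).
    by apply: borel_open; exact: open_addl.
  case: i => [|i] /=.
    rewrite (_ : [set _ | _] = [set y | V (- a + y)])//.
    apply/seteqP; split=> y /=; case: asboolP; rewrite addrC//.
  rewrite (_ : [set _ | _] = ~` [set y | V (- a + y)] `&`
      [set y | find (fun x => `[< V (y - x) >]) s = i]).
    by apply: measurableI; [exact: measurableC|exact: IH].
  apply/seteqP; split=> y /=; case: asboolP => [Vy|nVy] //; rewrite addrC.
  - by move=> [] <-; split.
  - by case.
  - by move=> [_ ->].
- by move=> y; rewrite -has_find; apply/hasP; have [x xs Vy] := cs y; exists x => //; exact/asboolP.
- move=> x y Nxy.
  have H z : V (z - nth 0 s (find (fun x => `[< V (z - x) >]) s)).
    apply/asboolP; apply: (@nth_find _ 0 (fun x => `[< V (z - x) >])).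
    by apply/hasP; have [b bs Vz] := cs z; exists b => //; exact/asboolP.
  have := H x; rewrite Nxy => /VN Vx; have := VW _ _ (H y) Vx.
  by rewrite opprB addrA subrK.
Qed.

Variables (r k : G -> R) (L M a : R) (O W : set G).
Hypotheses (rM : ess_le m L (r : borel G -> R)) (rk : {ae m, forall x, r x = k x}).
Hypotheses (kM : forall x, `|k x| <= M) (mO : measurable (O : set (borel G))).
Hypotheses (Oa : fine (m O) <= a).
Hypothesis kW : forall z v, ~ O z -> W v -> `|k z - k (z + v)| <= a.

Lemma Rintegral_addl_close x E (s : G -> R) Ms : measurable (E : set (borel G)) ->
  ess_le m Ms (s : borel G -> R) ->
  {ae m, forall y, E y -> exists2 v, W v & s y = k (x + y + v)} ->
  `|\int[m]_(y in E) r (x + y) - \int[m]_(y in E) s y| <= a + 2 * M * a.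
Proof.
move=> mE es sk.
have er := ess_le_addl m_haar x rM.
have a0 : 0 <= a by apply: le_trans Oa; exact: fine_mu_ge0.
have M0 : 0 <= M by exact: le_trans (normr_ge0 _) (kM 0).
rewrite -RintegralB//; [|exact: ess_le_integrable er|exact: ess_le_integrable es].
have ed := ess_leB er es.
have mO' : measurable ([set y | O (x + y)] : set (borel G)) by exact: borel_addl_set.
rewrite (Rintegral_setID mE mO' (ess_le_integrable mE ed)) addrC.
have rk' := ae_addl m_haar x rk.
apply: le_trans (ler_normD _ _) _; apply: lerD.
  apply: (@le_trans _ _ (a * fine (m (E `\` [set y | O (x + y)])))).
    apply: ae_norm_Rintegral_le; [exact: measurableD|by case: ed|].
    by apply: filterS2 rk' sk => y ry sy [/sy[v Wv ->] nO]; rewrite ry; exact: kW.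
  by rewrite ler_piMr// fine_mu_le1//; exact: measurableD.
apply: (@le_trans _ _ (2 * M * fine (m (E `&` [set y | O (x + y)])))).
  apply: ae_norm_Rintegral_le; [exact: measurableI|by case: ed|].
  apply: filterS2 rk' sk => y ry sy [/sy[v Wv ->] _]; rewrite ry.
  by rewrite (le_trans (ler_normB _ _))// mulr_natl mulr2n lerD.
rewrite ler_wpM2l ?mulr_ge0//; apply: le_trans Oa.
rewrite -[X in _ <= fine X](haar_addl m_haar x mO).
by apply: fine_mu_le => //; exact: measurableI.
Qed.

End riemann_sums.

(** * Complex integrals and the space of classes of essentially bounded functions *)

Section complex_integral.
Context d (T : measurableType d) (R : realType) (mu : probability T R).
Implicit Types (f g : T -> R[i]) (a : R[i]) (M N : R).

Definition cess_le M f :=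
  ess_le mu M (fun x => complex.Re (f x)) /\ ess_le mu M (fun x => complex.Im (f x)).

Lemma cess_leP M f : cmeasurable f -> {ae mu, forall x, normc (f x) <= M} -> cess_le M f.
Proof.
move=> [mR mI] fM; split; split=> //; apply: filterS fM => x; apply: le_trans.
- exact: normc_Re.
- exact: normc_Im.
Qed.

Lemma cess_le_measurable M f : cess_le M f -> cmeasurable f.
Proof. by move=> [[? _] [? _]]. Qed.

Lemma cess_leW M N f : M <= N -> cess_le M f -> cess_le N f.
Proof.
by move=> MN [[? h1] [? h2]]; split; split => //;
  [apply: filterS h1|apply: filterS h2] => x /le_trans; apply.
Qed.

Lemma cess_le_cst a : cess_le (normc a) (cst a).
Proof. by apply: cess_leP; [split; exact: measurable_cst|exact: nearW]. Qed.

Lemma cess_leD M N f g : cess_le M f -> cess_le N g -> cess_le (M + N) (f \+ g).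
Proof.
move=> [f1 f2] [g1 g2]; split.
  by under eq_fun do rewrite ReD; exact: ess_leD.
by under eq_fun do rewrite ImD; exact: ess_leD.
Qed.

Lemma cess_leM M N f g : cess_le M f -> cess_le N g -> cess_le (2 * (M * N)) (f \* g).
Proof.
move=> [f1 f2] [g1 g2]; rewrite mulr_natl mulr2n; split.
  by under eq_fun do rewrite ReM; apply: ess_leB; exact: ess_leM.
by under eq_fun do rewrite ImM; apply: ess_leD; exact: ess_leM.
Qed.

Lemma cintegral_ae f g : cmeasurable f -> cmeasurable g ->
  {ae mu, forall x, f x = g x} -> cintegral mu f = cintegral mu g.
Proof.
move=> [f1 f2] [g1 g2] fg; congr (_ +i* _); apply: ae_eq_Rintegral => //;
  by apply: filterS fg => x ->.
Qed.

Lemma cintegralD M N f g : cess_le M f -> cess_le N g ->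
  cintegral mu (f \+ g) = cintegral mu f + cintegral mu g.
Proof.
move=> [f1 f2] [g1 g2]; rewrite /cintegral.
under eq_Rintegral do rewrite ReD; under [X in _ +i* X]eq_Rintegral do rewrite ImD.
by rewrite !RintegralD//; try exact: ess_le_integrable f1; try exact: ess_le_integrable f2;
  try exact: ess_le_integrable g1; exact: ess_le_integrable g2.
Qed.

Lemma cintegralZ M a f : cess_le M f -> cintegral mu (fun x => a * f x) = a * cintegral mu f.
Proof.
move=> [f1 f2]; have i1 := ess_le_integrable measurableT f1.
have i2 := ess_le_integrable measurableT f2.
have j1 c := ess_le_integrable measurableT (ess_leZ c f1).
have j2 c := ess_le_integrable measurableT (ess_leZ c f2).
rewrite /cintegral; under eq_Rintegral do rewrite ReM.
under [X in _ +i* X]eq_Rintegral do rewrite ImM.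
by rewrite RintegralB// RintegralD// !RintegralZl//; case: a.
Qed.

Lemma cintegral_le M f : cess_le M f -> normc (cintegral mu f) <= 2 * M.
Proof.
move=> [[f1 f2] [g1 g2]]; apply: le_trans (normc_le_ReIm _) _.
have mT : fine (mu [set: T]) = 1 by rewrite probability_setT.
rewrite mulr_natl mulr2n; apply: lerD; rewrite -[leRHS]mulr1 -mT;
  apply: ae_norm_Rintegral_le => //; [apply: filterS f2|apply: filterS g2] => x //.
Qed.

End complex_integral.

Section Linfty_tools.
Context d (T : measurableType d) (R : realType) (mu : probability T R).
Implicit Types (f g : Linfty mu) (h : T -> R[i]) (a : R[i]) (M : R) (D : set T).

Definition nrm f : R := fine (ess_norm mu f).

Lemma nrmE f : `|f| = (nrm f)%:C.
Proof. by []. Qed.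

Lemma nrm_ge0 f : 0 <= nrm f.
Proof. by rewrite -lee_fin Linfty_normE ess_norm_ge0. Qed.

Lemma Linfty_ae_le f : {ae mu, forall x, normc (f x) <= nrm f}.
Proof.
have := ess_sup_ge mu (fun x => (normc (f x))%:E).
by rewrite -/(ess_norm mu f) -Linfty_normE; apply: filterS => x; rewrite lee_fin.
Qed.

Lemma nrm_le M f : {ae mu, forall x, normc (f x) <= M} -> nrm f <= M.
Proof.
move=> fM; rewrite -lee_fin Linfty_normE; apply/ess_supP.
by apply: filterS fM => x; rewrite lee_fin.
Qed.

Lemma Linfty_cess_le f : cess_le mu (nrm f) f.
Proof.
apply: cess_leP (Linfty_ae_le f).
by have := valP (repr f : ebfun mu); rewrite inE => -[].
Qed.

Lemma nrmD f g : nrm (f + g) <= nrm f + nrm g.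
Proof. by have := ler_normD f g; rewrite !nrmE -rmorphD lecR. Qed.

Lemma nrmZ a f : nrm (a *: f) = normc a * nrm f.
Proof.
by have := normrZ a f; rewrite !nrmE Defs.normrE -rmorphM => /complexI.
Qed.

Lemma nrmN f : nrm (- f) = nrm f.
Proof. by have := normrN f; rewrite !nrmE => /complexI. Qed.

Lemma ess_boundedP M h : cess_le mu M h -> h \in ess_bounded mu.
Proof.
move=> hM; rewrite inE; split; first exact: cess_le_measurable hM.
apply: (@le_lt_trans _ _ (M + M)%:E); last exact: ltry.
case: hM => -[_ h1] [_ h2]; apply/ess_supP; apply: filterS2 h1 h2 => x h1 h2.
by rewrite lee_fin (le_trans (normc_le_ReIm _))// lerD.
Qed.

Definition cls h : Linfty mu := \pi_(Linfty mu) (insubd (0 : ebfun mu) h).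

Lemma cls_ae M h : cess_le mu M h -> {ae mu, forall x, cls h x = h x}.
Proof.
move=> hM; have := Linfty_pi_ae (insubd (0 : ebfun mu) h).
apply: filterS => x ->; have := val_insubd (0 : ebfun mu) h.
by rewrite (ess_boundedP hM) => ->.
Qed.

Definition intRe D f : R := \int[mu]_(x in D) complex.Re (f x).

Lemma intRe_ae D f h : measurable D -> cmeasurable h ->
  {ae mu, forall x, f x = h x} -> intRe D f = \int[mu]_(x in D) complex.Re (h x).
Proof.
move=> mD [mh _] fh; apply: ae_eq_Rintegral => //; first by case: (Linfty_cess_le f) => -[].
by apply: filterS fh => x ->.
Qed.

Lemma intRe_le D f : measurable D -> `|intRe D f| <= nrm f.
Proof.
move=> mD; have [[mf fn] _] := Linfty_cess_le f.
apply: le_trans (ae_norm_Rintegral_le (M := nrm f) mD mf _) _.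
  by apply: filterS fn => x.
by rewrite ler_piMr ?nrm_ge0// fine_mu_le1.
Qed.

Lemma intReD D f g : measurable D -> intRe D (f + g) = intRe D f + intRe D g.
Proof.
move=> mD; have [f1 _] := Linfty_cess_le f; have [g1 _] := Linfty_cess_le g.
rewrite /intRe -RintegralD//; [|exact: ess_le_integrable f1|exact: ess_le_integrable g1].
apply: ae_eq_Rintegral => //.
- by case: (Linfty_cess_le (f + g : Linfty mu)) => -[].
- by apply: measurable_funD; [case: f1|case: g1].
- by apply: filterS (LinftyD_ae f g) => x -> _; rewrite ReD.
Qed.

Lemma intReZ D (c : R) f : measurable D -> intRe D (c%:C *: f) = c * intRe D f.
Proof.
move=> mD; have [f1 _] := Linfty_cess_le f.
rewrite /intRe -RintegralZl//; last exact: ess_le_integrable f1.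
apply: ae_eq_Rintegral => //.
- by case: (Linfty_cess_le (c%:C *: f : Linfty mu)) => -[].
- by apply: measurable_funM; [exact: measurable_cst|case: f1].
- by apply: filterS (Linfty_scale_ae c%:C f) => x fx _; rewrite fx ReM /= mul0r subr0.
Qed.

Lemma intReB D f g : measurable D -> intRe D (f - g) = intRe D f - intRe D g.
Proof.
move=> mD; rewrite intReD//; congr (_ + _).
have -> : - g = (-1)%:C *: g :> Linfty mu by rewrite rmorphN rmorph1 scaleN1r.
by rewrite intReZ// mulN1r.
Qed.

End Linfty_tools.

Section spectral_spaces.
Variables (R : realType) (G : topologicalZmodType) (m : probability (borel G) R).
Variable Lambda : set (character R G).
Implicit Types (gamma : character R G) (f g : Linfty m) (h k : G -> R[i]).

Lemma normc_character gamma x : normc (gamma x) = 1.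
Proof. by have := character_norm1 gamma x; rewrite Defs.normrE => /complexI. Qed.

Lemma normc_conj (z : R[i]) : normc (z^*)%C = normc z.
Proof. by case: z => a b /=; rewrite sqrrN. Qed.

Lemma cess_le_conj_character gamma : cess_le m 1 (fun x : borel G => (gamma x)^*%C).
Proof.
have [mR mI] := cmeasurable_continuous (@character_continuous _ _ gamma).
apply: cess_leP; last by apply: nearW => x; rewrite normc_conj normc_character.
split; first by move: mR; congr measurable_fun; apply/funext => x /=; case: (gamma x).
rewrite (_ : (fun _ => _) = fun x => - complex.Im (gamma x)); first exact: measurableT_comp.
by apply/funext => x /=; case: (gamma x).
Qed.

Lemma cess_le_fourier M h gamma : cess_le m M (h : borel G -> R[i]) ->
  cess_le m (2 * M) (fun x : borel G => h x * (gamma x)^*%C).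
Proof. by move=> hM; rewrite -[M]mulr1; exact: cess_leM (cess_le_conj_character _). Qed.

Lemma fourier_ae M N h k gamma :
  cess_le m M (h : borel G -> R[i]) -> cess_le m N (k : borel G -> R[i]) ->
  {ae m, forall x, h x = k x} -> fourier m h gamma = fourier m k gamma.
Proof.
move=> hM kN hk; apply: cintegral_ae.
- exact: cess_le_measurable (cess_le_fourier gamma hM).
- exact: cess_le_measurable (cess_le_fourier gamma kN).
- by apply: ae_imp hk _ => x hkx; rewrite hkx.
Qed.

Lemma fourierD f g gamma :
  fourier m (f + g : Linfty m) gamma = fourier m f gamma + fourier m g gamma.
Proof.
have cf := Linfty_cess_le f; have cg := Linfty_cess_le g.
rewrite (fourier_ae _ (Linfty_cess_le _) (cess_leD cf cg) (LinftyD_ae f g)).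
rewrite /fourier -(cintegralD (cess_le_fourier gamma cf) (cess_le_fourier gamma cg)).
by congr cintegral; apply/funext => x /=; rewrite mulrDl.
Qed.

Lemma fourierZ a f gamma :
  fourier m (a *: f : Linfty m) gamma = a * fourier m f gamma.
Proof.
have cf := Linfty_cess_le f.
rewrite (fourier_ae _ (Linfty_cess_le _) (cess_leM (cess_le_cst m a) cf) (Linfty_scale_ae a f)).
rewrite /fourier -(cintegralZ _ (cess_le_fourier gamma cf)).
by congr cintegral; apply/funext => x /=; rewrite mulrA.
Qed.

Lemma fourier_le f gamma : normc (fourier m f gamma) <= 4 * nrm f.
Proof.
apply: le_trans (cintegral_le (cess_le_fourier gamma (Linfty_cess_le f))) _.
by rewrite mulrA -natrM.
Qed.

Lemma Linfty_spec0 : Linfty_spec m Lambda 0.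
Proof.
by move=> gamma _; rewrite -[0 : Linfty m](scale0r 0) fourierZ mul0r.
Qed.

Lemma Linfty_specD f g :
  Linfty_spec m Lambda f -> Linfty_spec m Lambda g -> Linfty_spec m Lambda (f + g).
Proof. by move=> fL gL gamma nL; rewrite fourierD fL// gL// addr0. Qed.

Lemma Linfty_specZ a f : Linfty_spec m Lambda f -> Linfty_spec m Lambda (a *: f).
Proof. by move=> fL gamma nL; rewrite fourierZ fL// mulr0. Qed.

Lemma Linfty_specB f g :
  Linfty_spec m Lambda f -> Linfty_spec m Lambda g -> Linfty_spec m Lambda (f - g).
Proof. by move=> fL gL; rewrite -scaleN1r; apply: Linfty_specD => //; exact: Linfty_specZ. Qed.

Lemma Linfty_spec_cls M h : cess_le m M (h : borel G -> R[i]) ->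
  (forall gamma, ~ Lambda gamma -> fourier m h gamma = 0) -> Linfty_spec m Lambda (cls m h).
Proof.
move=> hM h0 gamma nL.
by rewrite (fourier_ae _ (Linfty_cess_le _) hM (cls_ae hM)) h0.
Qed.

Hypothesis G_compact : compact [set: G].

Lemma continuous_cess_le h : continuous h -> exists M, cess_le m M (h : borel G -> R[i]).
Proof.
move=> ch; have [M hM] := compact_normc_bounded G_compact ch.
by exists M; apply: cess_leP; [exact: cmeasurable_continuous|exact: nearW].
Qed.

Lemma C_spec_cls h : continuous h ->
  (forall gamma, ~ Lambda gamma -> fourier m h gamma = 0) -> C_spec m Lambda (cls m h).
Proof.
move=> ch h0; have [M hM] := continuous_cess_le ch.
by exists h; split => //; exact: cls_ae hM.
Qed.

Lemma C_spec_Linfty_spec : C_spec m Lambda `<=` Linfty_spec m Lambda.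
Proof.
move=> f [g [cg fg g0]] gamma nL; have [M gM] := continuous_cess_le cg.
by rewrite (fourier_ae _ (Linfty_cess_le f) gM fg) g0.
Qed.

Hypothesis m_haar : is_haar m.

Lemma cess_le_addl M t h : cess_le m M (h : borel G -> R[i]) ->
  cess_le m M (fun x : borel G => h (t + x)).
Proof. by move=> [h1 h2]; split; [exact: ess_le_addl h1|exact: ess_le_addl h2]. Qed.

Lemma cintegral_addl M t h : cess_le m M (h : borel G -> R[i]) ->
  cintegral m (h : borel G -> R[i]) = cintegral m (fun x : borel G => h (t + x)).
Proof.
move=> [h1 h2]; congr (_ +i* _).
  by rewrite (Rintegral_addl _ t _ h1).
by rewrite (Rintegral_addl _ t _ h2).
Qed.

Definition translate (t : G) f : Linfty m := cls m (fun x => f (t + x)).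

Lemma translate_ae t f : {ae m, forall x, translate t f x = f (t + x)}.
Proof. exact: cls_ae (cess_le_addl t (Linfty_cess_le f)). Qed.

Lemma nrm_translate t f : nrm (translate t f) <= nrm f.
Proof.
apply: nrm_le; apply: ae_imp2 (translate_ae t f) (ae_addl m_haar t (Linfty_ae_le f)) _.
by move=> x ->.
Qed.

Lemma Linfty_spec_translate t f :
  Linfty_spec m Lambda f -> Linfty_spec m Lambda (translate t f).
Proof.
move=> fL; apply: Linfty_spec_cls (cess_le_addl t (Linfty_cess_le f)) _ => gamma nL.
have := cintegralZ (gamma (- t))^*%C (cess_le_fourier gamma (Linfty_cess_le f)).
rewrite -[X in _ = _ * X]/(fourier m f gamma) fL// mulr0.
rewrite (cintegral_addl t (cess_leM (cess_le_cst m (gamma (- t))^*%C)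
  (cess_le_fourier gamma (Linfty_cess_le f)))) => <-.
congr cintegral; apply/funext => x /=.
rewrite mulrCA; congr (_ * _); rewrite -rmorphM -characterD addrA addNr add0r//.
Qed.

End spectral_spaces.

Section convolution.
Variables (R : realType) (G : topologicalZmodType) (m : probability (borel G) R).
Hypothesis G_compact : compact [set: G].
Hypothesis m_haar : is_haar m.

Lemma riemann_integrable_modulus (h : G -> R[i]) (a : R) : riemann_integrable m h -> 0 < a ->
  exists O W : set G, [/\ measurable (O : set (borel G)), fine (m O) <= a, nbhs 0 W &
    forall z v, ~ O z -> W v -> normc (h z - h (z + v)) <= a].
Proof.
move=> [_ [N [mN N0 hN]]] a0.
have [_ mNE _] := m_haar mN.
have : (m N < a%:E)%E by rewrite N0 lte_fin.
rewrite [X in (X < _)%E]mNE => /ereal_inf_lt[_ [U [oU NU] <-] Ua].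
have mU : measurable (U : set (borel G)) by exact: borel_open.
have cU : compact (~` U).
  by apply: (subclosed_compact _ G_compact) => //; exact: open_closedC.
have hO x : (~` U) x -> {for x, continuous h}.
  by move=> nOx; apply: contrapT => nhx; apply: nOx; apply: NU; exact: hN.
exists U, [set v | forall x, (~` U) x -> normc (h x - h (x + v)) <= a]; split => //.
- by rewrite -lee_fin fine_muK// ltW.
- exact: compact_unif_continuous cU hO a0.
- by move=> z v nO; exact.
Qed.

Variables (f : Linfty m) (h : G -> R[i]).
Hypothesis h_ri : riemann_integrable m h.
Hypothesis fh : {ae m, forall x, f x = h x}.

Definition cint (E : set (borel G)) (s : G -> R[i]) : R[i] :=
  (\int[m]_(y in E) complex.Re (s y)) +i* (\int[m]_(y in E) complex.Im (s y)).

Definition conv_set E (x : G) : R[i] := cint E (fun y => f (x + y)).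

Lemma conv_set_close (b : R) : 0 < b -> exists W : set G, nbhs 0 W /\
  forall (E : set (borel G)) x (s : G -> R[i]) Ms,
    measurable E -> cess_le m Ms (s : borel G -> R[i]) ->
    {ae m, forall y, E y -> exists2 v, W v & s y = h (x + y + v)} ->
    normc (conv_set E x - cint E s) <= b.
Proof.
move=> b0; have [M hM] := h_ri.1.
have M0 : 0 <= M by exact: le_trans (normc_ge0 _) (hM 0).
pose a := b / (2 * (1 + 2 * M)).
have a0 : 0 < a by rewrite divr_gt0// mulr_gt0// ltr_pwDl// mulr_ge0.
have ab : b = (a + 2 * M * a) + (a + 2 * M * a).
  by rewrite /a; field; lra.
have [U [W [mO Oa W0 hW]]] := riemann_integrable_modulus h_ri a0.
exists W; split => // E x s Ms mE sM sh.
have [fR fI] := Linfty_cess_le f; have [sR sI] := sM.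
have close (r : R[i] -> R) : (forall z, `|r z| <= normc z) ->
    (forall z w, r (z - w) = r z - r w) ->
    ess_le m (nrm f) (fun y : borel G => r (f y)) ->
    ess_le m Ms (fun y : borel G => r (s y)) ->
    `|\int[m]_(y in E) r (f (x + y)) - \int[m]_(y in E) r (s y)| <= a + 2 * M * a.
  move=> r_le rB rf rs.
  apply: (@Rintegral_addl_close _ _ _ m_haar (r \o f) (r \o h) (nrm f) M a U W rf _ _ mO Oa _
    x E (r \o s) Ms mE rs).
  - by apply: ae_imp fh _ => z /= ->.
  - by move=> z /=; exact: le_trans (r_le _) (hM z).
  - by move=> z v nOz Wv /=; rewrite -rB; apply: le_trans (r_le _) _; exact: hW.
  - by apply: ae_imp sh _ => y sy Ey; have [v Wv sE] := sy Ey; exists v => //=; rewrite sE.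
have cR := close _ (@normc_Re R) (@ReB R) fR sR.
have cI := close _ (@normc_Im R) (@ImB R) fI sI.
rewrite ab; apply: le_trans (normc_le_ReIm _) _; apply: lerD.
  by rewrite ReB.
by rewrite ImB.
Qed.

Lemma conv_set_continuous E : measurable E -> continuous (conv_set E).
Proof.
move=> mE x; apply/continuous_normcP => e e0.
have e4 : 0 < e / 4 by rewrite divr_gt0.
have [W [W0 convW]] := conv_set_close e4.
have Wx : nbhs x [set y | W (- x + y)].
  by apply/nbhs_addl; apply: filterS W0 => v Wv; rewrite /= addKr.
apply: filterS Wx => x' Wx'.
have cs := cess_le_addl m_haar x' (Linfty_cess_le f).
have sh : {ae m, forall y, f (x' + y) = h (x' + y)} by exact: (ae_addl m_haar x' fh).
have W00 := nbhs_singleton W0.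
have c1 := convW E x _ _ mE cs; have c2 := convW E x' _ _ mE cs.
set I := cint _ _ in c1 c2.
have {}c1 : normc (conv_set E x - I) <= e / 4.
  apply: c1; apply: ae_imp sh _ => y fy _; exists (- x + x') => //.
  by rewrite fy; congr h; rewrite addrAC addrA subrr add0r.
have {}c2 : normc (conv_set E x' - I) <= e / 4.
  by apply: c2; apply: ae_imp sh _ => y fy _; exists 0 => //; rewrite fy addr0.
have -> : conv_set E x - conv_set E x' = (conv_set E x - I) - (conv_set E x' - I).
  by rewrite opprB addrA subrK.
apply: le_lt_trans (le_normcD _ _) _; rewrite normcN; lra.
Qed.

Lemma conv_set_cess_le E : measurable E ->
  exists M, cess_le m M (conv_set E : borel G -> R[i]).
Proof. by move=> mE; apply: continuous_cess_le => //; exact: conv_set_continuous. Qed.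

Lemma translate_h t : {ae m, forall x, translate t f x = h (t + x)}.
Proof. by apply: ae_imp2 (translate_ae m_haar t f) (ae_addl m_haar t fh) _ => x -> ->. Qed.

Lemma Linfty_sum_ae n (F : nat -> Linfty m) (k : nat -> G -> R[i]) :
  (forall i, {ae m, forall x, F i x = k i x}) ->
  {ae m, forall x, (\sum_(i < n) F i : Linfty m) x = \sum_(i < n) k i x}.
Proof.
move=> Fk; elim: n => [|n IH].
  rewrite big_ord0; have := Linfty_scale_ae 0 (0 : Linfty m).
  rewrite -[Linfty_scale _ _]/(0 *: (0 : Linfty m)) scale0r => h0.
  by apply: ae_imp h0 _ => x ->; rewrite big_ord0 mul0r.
rewrite big_ord_recr /=.
have F1 := LinftyD_ae (\sum_(i < n) F i) (F n).
by apply: ae_imp2 (ae_imp2 F1 IH (fun x a b => conj a b)) (Fk n) _ => x [-> ->] ->;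
  rewrite big_ord_recr.
Qed.

Lemma conv_set_approx (b : R) : 0 < b -> exists (n : nat) (N : G -> nat),
  [/\ forall i, measurable ([set x | N x = i] : set (borel G)),
      forall x, (N x < n)%N &
      forall (E : set (borel G)) (t : nat -> G), measurable E ->
        (forall y, N (t (N y)) = N y) ->
        nrm (cls m (conv_set E) -
          \sum_(i < n) (fine (m (E `&` [set y | N y = i])))%:C *: translate (t i) f) <= b].
Proof.
move=> b0; have [W [W0 convW]] := conv_set_close b0.
have [n [N [mN Nn NW]]] := fine_partition G_compact W0.
exists n, N; split => // E t mE Nt.
set c := fun i => fine (m (E `&` [set y | N y = i])).
have E1 : {ae m, forall x, (\sum_(i < n) (c i)%:C *: translate (t i) f : Linfty m) x =
    \sum_(i < n) (c i)%:C * h (t i + x)}.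
  apply: (Linfty_sum_ae n (F := fun i => (c i)%:C *: translate (t i) f)
    (k := fun i x => (c i)%:C * h (t i + x))) => i.
  apply: ae_imp2 (Linfty_scale_ae (c i)%:C (translate (t i) f)) (translate_h (t i)) _ => x ax tx.
  by rewrite [LHS]ax tx.
have [M cM] := conv_set_cess_le mE.
have E2 := cls_ae cM.
set S := \sum_(i < n) _.
apply: nrm_le.
have E3 : {ae m, forall x, (cls m (conv_set E) - S : Linfty m) x =
    conv_set E x - \sum_(i < n) (c i)%:C * h (t i + x)}.
  have E4 : {ae m, forall x, (- S : Linfty m) x = - (\sum_(i < n) (c i)%:C * h (t i + x))}.
    rewrite -scaleN1r; apply: ae_imp2 (Linfty_scale_ae (-1) S) E1 _ => x.
    by move=> + Sx; rewrite -[Linfty_scale _ _]/(-1 *: S) Sx mulN1r.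
  apply: ae_imp2 (LinftyD_ae (cls m (conv_set E)) (- S)) (ae_imp2 E2 E4 (fun x a b => conj a b)) _.
  by move=> x -> [-> ->].
apply: ae_imp E3 _ => x ->.
pose s y := h (x + t (N y)).
have [MR sR] := step_ess_le m (fun i => complex.Re (h (x + t i))) mN Nn.
have [MI sI] := step_ess_le m (fun i => complex.Im (h (x + t i))) mN Nn.
have sM : cess_le m (Num.max MR MI) (s : borel G -> R[i]).
  by split; [have := sR|have := sI]; move=> [? H]; split => //;
    apply: ae_imp H _ => y /le_trans; apply; rewrite le_max lexx ?orbT.
have -> : \sum_(i < n) (c i)%:C * h (t i + x) = cint E s.
  apply/eqP; rewrite eq_complex; apply/andP; split; apply/eqP.
    rewrite /= (Rintegral_step m (fun i => complex.Re (h (x + t i))) mN Nn mE).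
    rewrite (big_morph (@complex.Re R) (@ReD R) erefl).
    by apply: eq_bigr => i _; rewrite ReM /= mul0r subr0 addrC.
  rewrite /= (Rintegral_step m (fun i => complex.Im (h (x + t i))) mN Nn mE).
  rewrite (big_morph (@complex.Im R) (@ImD R) erefl).
  by apply: eq_bigr => i _; rewrite ImM /= mul0r addr0 addrC.
apply: convW mE sM _; apply: nearW => y Ey; exists (t (N y) - y); first exact: NW.
by rewrite /s [t _ - y]addrC addrA addrK.
Qed.

End convolution.

(** * Translates of a Riemann-integrable function *)

Section projection.
Variables (R : realType) (G : topologicalZmodType) (m : probability (borel G) R).
Hypothesis G_compact : compact [set: G].
Hypothesis m_haar : is_haar m.
Variables (Lambda : set (character R G)) (P : Linfty m -> Linfty m).
Hypothesis P_proj : bounded_projection (Linfty_spec m Lambda) (C_spec m Lambda) P.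
Implicit Types f g : Linfty m.

Let L := Linfty_spec m Lambda.

Definition defect f : Linfty m := f - P f.

Lemma defect_lin a f g : L f -> L g -> defect (a *: f + g) = a *: defect f + defect g.
Proof.
have [Plin _ _ _ _] := P_proj.
by move=> Lf Lg; rewrite /defect Plin// scalerBr opprD addrACA.
Qed.

Lemma defect_C f : C_spec m Lambda f -> defect f = 0.
Proof. by have [_ _ _ _ PC] := P_proj; move=> Cf; rewrite /defect PC// subrr. Qed.

Lemma defect0 : defect 0 = 0.
Proof.
have := defect_lin (-1) (@Linfty_spec0 _ _ m Lambda) (@Linfty_spec0 _ _ m Lambda).
by rewrite scaler0 addr0 scaleN1r addNr.
Qed.

Lemma C_P f : L f -> C_spec m Lambda (P f).
Proof. by have [_ _ _ PE _] := P_proj; move=> Lf; rewrite -PE; exists f. Qed.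

Lemma defect_bounded : exists2 K : R, 0 <= K & forall f, L f -> nrm (defect f) <= K * nrm f.
Proof.
have [_ [M PM] _ _ _] := P_proj; exists (1 + `|M|) => [|f Lf].
  by rewrite addr_ge0.
apply: le_trans (nrmD _ _) _; rewrite nrmN mulrDl mul1r lerD2l.
have := PM f Lf; rewrite !nrmE -rmorphM lecR => /le_trans; apply.
by rewrite ler_wpM2r ?nrm_ge0// ler_norm.
Qed.

Lemma Linfty_spec_sum n (c : nat -> R[i]) (F : nat -> Linfty m) :
  (forall i, L (F i)) -> L (\sum_(i < n) c i *: F i).
Proof.
move=> LF; elim: n => [|n IH]; first by rewrite big_ord0; exact: Linfty_spec0.
rewrite big_ord_recr /=; apply: Linfty_specD; first exact: IH.
exact: Linfty_specZ (LF n).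
Qed.

Lemma defect_sum n (c : nat -> R[i]) (F : nat -> Linfty m) :
  (forall i, L (F i)) ->
  defect (\sum_(i < n) c i *: F i) = \sum_(i < n) c i *: defect (F i).
Proof.
move=> LF; elim: n => [|n IH]; first by rewrite !big_ord0; exact: defect0.
rewrite !big_ord_recr /= -IH addrC defect_lin//; first by rewrite addrC.
exact: Linfty_spec_sum.
Qed.

Lemma intRe_sum D n (c : nat -> R) (F : nat -> Linfty m) : measurable D ->
  intRe D (\sum_(i < n) (c i)%:C *: F i) = \sum_(i < n) c i * intRe D (F i).
Proof.
move=> mD; elim: n => [|n IH].
  rewrite !big_ord0 -(scale0r (0 : Linfty m)) -[0 : R[i]]/(0%:C).
  by rewrite intReZ// mul0r.
by rewrite !big_ord_recr /= intReD// IH intReZ.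
Qed.

Section riemann_integrable.
Variables (f : Linfty m) (h : G -> R[i]).
Hypothesis Lf : L f.
Hypothesis h_ri : riemann_integrable m h.
Hypothesis fh : {ae m, forall x, f x = h x}.

Lemma C_spec_conv_set E : measurable E -> C_spec m Lambda (cls m (conv_set f E)).
Proof.
move=> mE; have ch := conv_set_continuous G_compact m_haar h_ri fh mE.
apply: C_spec_cls => // gamma nL.
have [M cM] := continuous_cess_le m G_compact ch.
rewrite -(fourier_ae gamma (Linfty_cess_le _) cM (cls_ae cM)).
set F := fourier _ _ _.
have F0 b : 0 < b -> normc F <= 4 * b.
  move=> b0; have [n [N [mN Nn NE]]] := conv_set_approx G_compact m_haar h_ri fh b0.
  have /choice[t tN] : forall i, exists x, forall y, N y = i -> N x = i.
    move=> i; have [[y Ny]|nex] := pselect (exists y, N y = i).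
      by exists y.
    by exists 0 => y Ny; exfalso; apply: nex; exists y.
  have Nt y : N (t (N y)) = N y by exact: tN.
  have := NE E t mE Nt; set S := \sum_(i < n) _ => leb.
  have LS : L S.
    exact: (Linfty_spec_sum n (fun i => (fine (m (E `&` [set y | N y = i])))%:C)
      (fun i => Linfty_spec_translate m_haar (t i) Lf)).
  apply: le_trans (_ : 4 * nrm (cls m (conv_set f E) - S) <= _); last by rewrite ler_pM2l.
  apply: le_trans (fourier_le _ gamma); rewrite le_eqVlt; apply/orP; left; apply/eqP.
  congr normc; rewrite fourierD -scaleN1r fourierZ LS// mulr0 addr0//.
apply: eq0_normc; apply/eqP; rewrite eq_le normc_ge0 andbT.
apply/ler_addgt0Pr => e e0; rewrite add0r.
have e4 : 0 < e / 4 by rewrite divr_gt0.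
by apply: le_trans (F0 _ e4) _; rewrite mulrC divfK.
Qed.

(* If A is not negligible, then the averages of the translates of f by elements of A are close
   to continuous functions 1_E * f, which the defect kills, with m(E) bounded below. *)
Lemma defect_negligible (D : set (borel G)) (A : set G) (sgn : R) e : measurable D ->
  0 < e -> (forall t, A t -> e <= sgn * intRe D (defect (translate t f))) ->
  m.-negligible (A : set (borel G)).
Proof.
move=> mD e0 Ae; apply: contrapT => nA.
have [eta eta0 Aeta] : exists2 eta : R, 0 < eta &
    forall E : set (borel G), measurable E -> A `<=` E -> eta <= fine (m E).
  apply: contrapT => nex; apply: nA.
  have /choice[E EP] : forall n, exists E : set (borel G),
      [/\ measurable E, A `<=` E & fine (m E) < n.+1%:R^-1].
    move=> n; apply: contrapT => nE; apply: nex; exists n.+1%:R^-1 => [|E mE AE].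
      by rewrite invr_gt0 ltr0n.
    by rewrite leNgt; apply/negP => ltE; apply: nE; exists E.
  exists (\bigcap_n E n); split.
  - by apply: bigcap_measurable => // n _; have [] := EP n.
  - apply/eqP; rewrite eq_le measure_ge0 andbT.
    have mI : measurable (\bigcap_n E n) by apply: bigcap_measurable => // n _; have [] := EP n.
    rewrite -(fine_muK m mI) lee_fin; apply/ler_addgt0Pr => d d0; rewrite add0r.
    have [k kd] : exists k : nat, k.+1%:R^-1 < d.
      have := @near_infty_natSinv_lt R (PosNum d0).
      by move=> [k _ kd]; exists k; exact: (kd k (leqnn k)).
    have [mE _ Ek] := EP k; apply: ltW; apply: le_lt_trans (lt_trans Ek kd).
    by apply: fine_mu_le => // x Ex; exact: Ex.
  - by move=> x Ax n _; have [_ AE _] := EP n; exact: AE.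
have [K K0 defK] := defect_bounded.
pose b := e * eta / (2 * (1 + `|sgn| * K)).
have sK : 0 < 1 + `|sgn| * K by rewrite ltr_pwDl// mulr_ge0.
have b0 : 0 < b by rewrite divr_gt0// ?mulr_gt0.
have [n [N [mN Nn NE]]] := conv_set_approx G_compact m_haar h_ri fh b0.
have /choice[t tN] : forall i, exists x, (forall y, N y = i -> N x = i) /\
    ((exists2 y, A y & N y = i) -> A x).
  move=> i; have [[y Ay Ny]|nA'] := pselect (exists2 y, A y & N y = i).
    by exists y.
  have [[y Ny]|nex] := pselect (exists y, N y = i).
    by exists y; split.
  by exists 0; split => // y Ny; exfalso; apply: nex; exists y.
pose E : set (borel G) := \bigcup_(i in [set i | exists2 y, A y & N y = i]) [set y | N y = i].
have mE : measurable E by apply: bigcup_measurable => i _.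
have AE : A `<=` E by move=> y Ay; exists (N y) => //; exists y.
pose c i := fine (m (E `&` [set y | N y = i])).
have sumc : \sum_(i < n) c i = fine (m E).
  have := Rintegral_step m (fun=> 1) mN Nn mE; rewrite Rintegral_cst// mul1r => ->.
  by apply: eq_bigr => i _; rewrite mulr1.
have Nt y : N (t (N y)) = N y by apply: (tN _).1.
have := NE E t mE Nt; rewrite -/(c _).
set S := \sum_(i < n) _ => leb.
have Ltr i : L (translate (t i) f) by exact: Linfty_spec_translate.
have LS : L S by exact: (Linfty_spec_sum n (fun i => (c i)%:C) Ltr).
have Cconv := C_spec_conv_set mE.
have Lconv := C_spec_Linfty_spec G_compact Cconv.
have dS : defect (cls m (conv_set f E) - S) = - defect S.
  by rewrite addrC -scaleN1r defect_lin// (defect_C Cconv) addr0 scaleN1r.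
have le1 : e * eta <= sgn * intRe D (defect S).
  rewrite (defect_sum n (fun i => (c i)%:C) Ltr).
  rewrite (intRe_sum n c (fun i => defect (translate (t i) f)) mD) mulr_sumr.
  apply: (@le_trans _ _ (e * \sum_(i < n) c i)).
    by rewrite sumc ler_pM2l//; exact: Aeta.
  rewrite mulr_sumr; apply: ler_sum => i _.
  have [[y Ay Ny]|nA'] := pselect (exists2 y, A y & N y = i).
    rewrite mulrCA mulrC ler_wpM2l ?fine_mu_ge0// Ae//.
    by apply: (tN i).2; exists y.
  have -> : c i = 0; last by rewrite mul0r !mulr0.
  rewrite /c (_ : E `&` _ = set0) ?measure0//; apply/seteqP; split => // z [[j [y Ay Nyj] Nzj] Nzi].
  by apply: nA'; exists y => //; rewrite Nyj -Nzj.
have le2 : sgn * intRe D (defect S) <= `|sgn| * (K * b).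
  apply: le_trans (ler_norm _) _; rewrite normrM ler_wpM2l//.
  apply: le_trans (intRe_le _ mD) _; rewrite -nrmN -dS.
  apply: le_trans (defK _ (Linfty_specB Lconv LS)) _.
  by rewrite ler_wpM2l.
have := le_trans le1 le2; rewrite leNgt => /negP; apply.
rewrite mulrA /b; set k := `|sgn| * K in sK *.
have k0 : 0 <= k by rewrite mulr_ge0.
have ee : 0 < e * eta by rewrite mulr_gt0.
rewrite mulrA ltr_pdivrMr ?mulr_gt0//; nra.
Qed.

End riemann_integrable.
End projection.

Section projection_tests.
Variables (R : realType) (G : topologicalZmodType) (m : probability (borel G) R).
Hypothesis G_compact : compact [set: G].
Hypothesis G_hausdorff : hausdorff_space G.
Hypothesis m_haar : is_haar m.
Variables (Lambda : set (character R G)) (P : Linfty m -> Linfty m).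
Hypothesis P_proj : bounded_projection (Linfty_spec m Lambda) (C_spec m Lambda) P.
Variables (f : Linfty m) (h : G -> R[i]).
Hypothesis Lf : Linfty_spec m Lambda f.
Hypothesis h_ri : riemann_integrable m h.
Hypothesis fh : {ae m, forall x, f x = h x}.

Let phi (U : set G) (t : G) : R :=
  intRe ([set y | U (t + y)] : set (borel G)) (defect P (translate t f)).

Lemma defect_translate_negligible_sgn (U : set G) (sgn e : R) : open U -> 0 < e ->
  `|sgn| = 1 -> m.-negligible ([set t | e <= sgn * phi U t] : set (borel G)).
Proof.
move=> oU e0 sgn1; set A := [set t | _].
have [K K0 defK] := defect_bounded P_proj.
pose B := K * nrm f; have B0 : 0 <= B by rewrite mulr_ge0// nrm_ge0.
pose d := e / (4 * (B + 1)).
have B1 : 0 < B + 1 by rewrite ltr_wpDl.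
have d0 : 0 < d by rewrite divr_gt0// mulr_gt0.
have dB : 2 * d * B <= e / 2.
  rewrite /d; have : B / (B + 1) <= 1 by rewrite ler_pdivrMr// mul1r lerDl.
  have -> : 2 * (e / (4 * (B + 1))) * B = e / 2 * (B / (B + 1)) by field; lra.
  by move=> ?; rewrite ler_piMr// ltW// divr_gt0.
have [n [N [mN Nn NW]]] :=
  fine_partition G_compact (Rintegral_open_addl G_hausdorff m_haar oU B0 d0).
have -> : A = \bigcup_i (A `&` [set t | N t = i]).
  by apply/seteqP; split=> [t At|t [i _ []//]]; exists (N t).
apply: negligible_bigcup => i.
have [[s [As Ns]]|nA] := pselect ((A `&` [set t | N t = i]) !=set0); last first.
  rewrite (_ : _ `&` _ = set0); first exact: negligible_set0.
  by apply/seteqP; split => // t At; apply: nA; exists t.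
have mD x : measurable ([set y | U (x + y)] : set (borel G)).
  by apply: borel_addl_set; exact: borel_open.
have e2 : 0 < e / 2 by rewrite divr_gt0.
have neg := defect_negligible G_compact m_haar P_proj Lf h_ri fh (mD s) e2.
apply: (neg _ sgn) => t [At Nt]; have Wst : N t = N s by rewrite Nt Ns.
pose q := defect P (translate t f).
have qB : nrm q <= B.
  apply: le_trans (defK _ (Linfty_spec_translate m_haar t Lf)) _.
  by rewrite ler_wpM2l// nrm_translate.
have qe : ess_le m B (fun y : borel G => complex.Re (q y)).
  by have [] := cess_leW qB (Linfty_cess_le q).
have := NW _ _ Wst t (fun y => complex.Re (q y)) qe; rewrite (addrC t (s - t)) subrK => close.
have {}close : `|intRe ([set y | U (t + y)] : set (borel G)) q -
    intRe ([set y | U (s + y)] : set (borel G)) q| <= e / 2.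
  by apply: le_trans dB.
have : sgn * (phi U t - intRe ([set y | U (s + y)] : set (borel G)) q) <= e / 2.
  by apply: le_trans (ler_norm _) _; rewrite normrM sgn1 mul1r.
move: At; rewrite /A /= -/q mulrBr; lra.
Qed.

Lemma defect_translate_negligible (U : set G) : open U ->
  m.-negligible ([set t | phi U t != 0] : set (borel G)).
Proof.
move=> oU.
have H (sgn : R) : `|sgn| = 1 ->
    m.-negligible (\bigcup_n [set t | n.+1%:R^-1 <= sgn * phi U t] : set (borel G)).
  move=> s1; apply: negligible_bigcup => n.
  have n0 : 0 < n.+1%:R^-1 :> R by rewrite invr_gt0 ltr0n.
  exact: (defect_translate_negligible_sgn oU n0 s1).
have H1 := H 1 (normr1 R); have HN1 := H (-1) (normrN1 R).
apply: negligibleS (negligibleU H1 HN1) => t /= pt.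
have near_inv (r : R) : 0 < r -> exists n, n.+1%:R^-1 <= r.
  move=> r0; have := @near_infty_natSinv_lt R (PosNum r0).
  by move=> [k _ kd]; exists k; apply: ltW; exact: (kd k (leqnn k)).
have [p0|p0|p0] := ltgtP (phi U t) 0.
- by right; have [|n ?] := near_inv (- phi U t); [rewrite oppr_gt0|exists n => //=; rewrite mulN1r].
- by left; have [n ?] := near_inv _ p0; exists n => //=; rewrite mul1r.
- by rewrite p0 eqxx in pt.
Qed.

Lemma exists_continuous_tests (U : nat -> set G) : (forall i, open (U i)) ->
  exists2 p : G -> R[i], continuous p &
    forall i, \int[m]_(y in U i) complex.Re (f y) = \int[m]_(y in U i) complex.Re (p y).
Proof.
move=> oU.
have [t tU] : exists t, forall i, phi (U i) t = 0.
  apply: contrapT => nt.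
  have : m.-negligible (\bigcup_i [set t | phi (U i) t != 0] : set (borel G)).
    by apply: negligible_bigcup => i; exact: defect_translate_negligible.
  rewrite (_ : \bigcup_i _ = setT); last first.
    apply/seteqP; split => // t _; apply: contrapT => nt'; apply: nt; exists t => i.
    by apply/eqP; apply: contrapT => pti; apply: nt'; exists i => //; exact/negP.
  move=> /(negligibleP _ measurableT) m0; have := probability_setT m.
  by rewrite [X in X = _]m0 => /esym/eqP; rewrite onee_eq0.
have Lt := Linfty_spec_translate m_haar t Lf.
have [p [cp Pp _]] := C_P P_proj Lt.
have ct : continuous (fun x => p (- t + x)).
  by move=> x; apply: continuous_comp; [exact: addl_continuous|exact: cp].
exists (fun x => p (- t + x)) => // i.
have mU : measurable (U i : set (borel G)) by exact: borel_open.
have mD : measurable ([set y | U i (t + y)] : set (borel G)) by exact: borel_addl_set.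
have [M [pM _]] := continuous_cess_le m G_compact ct.
have [fM _] := Linfty_cess_le f.
rewrite (Rintegral_addl m_haar t mU fM) (Rintegral_addl m_haar t mU pM).
under [RHS]eq_Rintegral do rewrite addKr.
have := tU i; rewrite /phi /defect intReB// => /eqP; rewrite subr_eq0 => /eqP.
rewrite (intRe_ae mD (cmeasurable_continuous cp) Pp) => <-.
rewrite (intRe_ae mD _ (translate_ae m_haar t f))//.
exact: cess_le_measurable (cess_le_addl m_haar t (Linfty_cess_le f)).
Qed.

Let cont := [set x : G | {for x, continuous h}].

Lemma Re_unif_continuous_on_cont (e : R) : 0 < e ->
  exists2 W : set G, nbhs 0 W & forall x y, cont x -> cont y -> W (x - y) ->
    complex.Re (h x) - complex.Re (h y) <= e.
Proof.
move=> e0; apply: contrapT => nunif.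
have /choice[XY XYP] : forall W : set G, exists p : G * G, nbhs 0 W ->
    [/\ cont p.1, cont p.2, W (p.1 - p.2) & e < complex.Re (h p.1) - complex.Re (h p.2)].
  move=> W; have [W0|nW] := pselect (nbhs 0 W); last by exists (0, 0).
  apply: contrapT => nex; apply: nunif; exists W => // x y cx cy Wxy.
  rewrite leNgt; apply/negP => lt; apply: nex; exists (x, y).
  by split; [exact: cx|exact: cy|exact: Wxy|exact: lt].
have e4 : 0 < e / 4 by rewrite divr_gt0.
pose A (n : nat) W := [set v | normc (h (XY W).1 - h ((XY W).1 + v)) <= e / 4 /\
                     normc (h (XY W).2 - h ((XY W).2 + v)) <= e / 4].
have near_cont x : cont x -> nbhs 0 [set v | normc (h x - h (x + v)) <= e / 4].
  move=> cx; apply/(nbhs_addl x [set y | normc (h x - h y) <= e / 4]).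
  by apply: filterS ((continuous_normcP _ _).1 cx _ e4) => y; exact: ltW.
have A0 n W : nbhs 0 W -> nbhs 0 (A n W).
  by move=> /XYP[c1 c2 _ _]; apply: filterI; exact: near_cont.
have [V [Vchain VA]] := nbhs_chain_ex A0.
have V0 i : nbhs 0 (V i) by apply: open_nbhs_nbhs; have [? ? _] := Vchain.1 i.
pose x i := (XY (V i)).1; pose y i := (XY (V i)).2.
pose U := core_nbhs V.
have oU i : open (U i) by exact: open_core_nbhs.
have UA i : U i `<=` A i (V i) by apply: core_nbhs_sub_add => //; exact: VA.
pose T n := if odd n then shift_set (U n./2) (x n./2)
  else shift_set (U n./2) (y n./2).
have [|p cp pT] := exists_continuous_tests (U := T).
  by move=> n; rewrite /T; case: ifP => _; exact: open_addl.
have mU i : measurable (U i : set (borel G)) by exact: borel_open.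
have [M [pM _]] := continuous_cess_le m G_compact cp.
have [fM _] := Linfty_cess_le f.
have fpx i : \int[m]_(u in U i) complex.Re (f (x i + u)) =
    \int[m]_(u in U i) complex.Re (p (x i + u)).
  have := pT i.*2.+1; rewrite /T /= odd_double /= uphalf_double.
  by rewrite (Rintegral_shift_set m_haar _ (oU i) fM) (Rintegral_shift_set m_haar _ (oU i) pM).
have fpy i : \int[m]_(u in U i) complex.Re (f (y i + u)) =
    \int[m]_(u in U i) complex.Re (p (y i + u)).
  have := pT i.*2; rewrite /T /= odd_double /= doubleK.
  by rewrite (Rintegral_shift_set m_haar _ (oU i) fM) (Rintegral_shift_set m_haar _ (oU i) pM).
have avg (a : G) i : (forall u, U i u -> normc (h a - h (a + u)) <= e / 4) ->
    `|complex.Re (h a) * fine (m (U i)) - \int[m]_(u in U i) complex.Re (f (a + u))| <=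
      e / 4 * fine (m (U i)).
  move=> aU; apply: (Rintegral_addl_near_cst m_haar (oU i) fM).
  apply: ae_imp (ae_addl m_haar a fh) _ => u /= -> Uu.
  by rewrite -ReB; apply: le_trans (normc_Re _) _; exact: aU.
have Vxy i : V i (x i - y i) by have [] := XYP _ (V0 i).
have infT N : exists2 i, (N <= i)%N & [set: nat] i by exists N.
have e8 : 0 < e / 8 by rewrite divr_gt0.
have UV i z Vz : [set u | U i (z + u)] = U i := core_nbhs_addl Vchain i Vz.
have [i _ merge] := averages_merge G_compact m_haar cp (nbhs_chain_closure Vchain) Vxy oU
  UV infT e8.
have [_ _ _ lt] := XYP _ (V0 i); rewrite -/(x i) -/(y i) in lt.
have ax : `|complex.Re (h (x i)) * fine (m (U i)) -
    \int[m]_(u in U i) complex.Re (f (x i + u))| <= e / 4 * fine (m (U i)).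
  by apply: avg => u /UA[].
have ay : `|complex.Re (h (y i)) * fine (m (U i)) -
    \int[m]_(u in U i) complex.Re (f (y i + u))| <= e / 4 * fine (m (U i)).
  by apply: avg => u /UA[].
have mU0 : 0 < fine (m (U i)).
  by apply: haar_open_gt0 => //; exists 0; exact: core_nbhs0.
move: merge ax ay; rewrite -fpx -fpy !ler_norml => /andP[_ h1] /andP[_ h2] /andP[h3 _].
set mu := fine (m (U i)) in h1 h2 h3 mU0.
have : (complex.Re (h (x i)) - complex.Re (h (y i))) * mu <= (e / 8 + e / 4 + e / 4) * mu by nra.
rewrite ler_pM2r//; lra.
Qed.

End projection_tests.

Section dense_extension.
Variables (R : realType) (G : topologicalZmodType).
Variables (k : G -> R) (D : set G) (M : R).
Hypothesis kM : forall x, `|k x| <= M.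
Hypothesis D_dense : forall (x : G) U, nbhs x U -> exists2 y, U y & D y.
Hypothesis k_unif : forall e : R, 0 < e ->
  exists2 W : set G, nbhs 0 W & forall x y, D x -> D y -> W (x - y) -> k x - k y <= e.

Lemma unif_continuous_limit x : exists c, forall e : R, 0 < e ->
  exists2 W : set G, nbhs 0 W & forall y, D y -> W (y - x) -> `|k y - c| <= e.
Proof.
pose F := k @ within D (nbhs x).
have FF : ProperFilter F.
  apply: fmap_proper_filter; split; last exact: within_filter.
  by move=> /D_dense[y Dy /Dy].
have [c [_ Fc]] : `[- M, M]%classic `&` cluster F !=set0.
  apply: (@segment_compact _ (- M) M) => //.
  by apply: nearW => y; rewrite /= in_itv /= -ler_norml.
exists c => e e0; have e2 : 0 < e / 2 by rewrite divr_gt0.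
have [W W0 kW] := k_unif e2.
have [V [oV V0 VN VW]] := nbhs0_add_sub W0.
exists V; first exact: open_nbhs_nbhs.
have Fx : F (k @` [set y | D y /\ V (y - x)]).
  have : nbhs x [set y | V (- x + y)].
    by apply: open_nbhs_nbhs; split; [exact: open_addl|rewrite /= addNr].
  by apply: filterS => y /= Vy Dy; exists y => //; split => //; rewrite addrC.
have [_ [[y0 [Dy0 Vy0] <-] ky0]] := Fc _ _ Fx (nbhsx_ballx c _ e2).
move=> y Dy Vy.
have le1 : k y - k y0 <= e / 2.
  apply: kW => //; have -> : y - y0 = (y - x) - (y0 - x) by rewrite opprB addrA subrK.
  by apply: VW => //; exact: VN.
have le2 : k y0 - k y <= e / 2.
  apply: kW => //; have -> : y0 - y = (y0 - x) - (y - x) by rewrite opprB addrA subrK.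
  by apply: VW => //; exact: VN.
move: ky0; rewrite -ball_normE /= ltr_norml => /andP[h1 h2].
rewrite ler_norml; apply/andP; split; lra.
Qed.

Lemma dense_extension : exists2 g : G -> R, continuous g & forall x, D x -> g x = k x.
Proof.
have /choice[g gP] := unif_continuous_limit.
exists g => [x|x Dx]; last first.
  apply/eqP; rewrite -subr_eq0 -normr_le0 distrC; apply/ler_addgt0Pr => e e0; rewrite add0r.
  have [W W0] := gP x e e0; apply=> //.
  by rewrite subrr; exact: nbhs_singleton.
apply/cvgrPdist_le => e e0; have e2 : 0 < e / 2 by rewrite divr_gt0.
have [W W0 kW] := gP x _ e2.
have [V [oV V0 VN VW]] := nbhs0_add_sub W0.
have Vx : nbhs x [set y | V (- x + y)].
  by apply: open_nbhs_nbhs; split; [exact: open_addl|rewrite /= addNr].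
apply: filterS Vx => x' Vx'.
have [W' W'0 kW'] := gP x' _ e2.
have : nbhs x' [set y | (V `&` W') (- x' + y)].
  apply/nbhs_addl; have : nbhs 0 (V `&` W') by apply: filterI => //; exact: open_nbhs_nbhs.
  by apply: filterS => v; rewrite /= addKr.
move=> /D_dense[y [Vy Wy] Dy].
have h1 : `|k y - g x'| <= e / 2 by apply: kW' => //; rewrite addrC.
have h2 : `|k y - g x| <= e / 2.
  apply: kW => //; have -> : y - x = (- x' + y) + (- x + x').
    by rewrite (addrC (- x') y) (addrC (- x) x') addrA subrK.
  exact: VW.
move: h1 h2; rewrite !ler_norml => /andP[a1 a2] /andP[a3 a4]; apply/andP; split; lra.
Qed.

End dense_extension.

Section riemann_integrable_functions.
Variables (R : realType) (G : topologicalZmodType) (m : probability (borel G) R).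
Hypothesis G_compact : compact [set: G].
Hypothesis G_hausdorff : hausdorff_space G.
Hypothesis m_haar : is_haar m.
Variables (Lambda : set (character R G)) (P : Linfty m -> Linfty m).
Hypothesis P_proj : bounded_projection (Linfty_spec m Lambda) (C_spec m Lambda) P.

Lemma riemann_integrable_C_spec (f : Linfty m) (h : G -> R[i]) :
  Linfty_spec m Lambda f -> riemann_integrable m h -> {ae m, forall x, f x = h x} ->
  C_spec m Lambda f.
Proof.
move=> Lf h_ri fh; have [[M hM] hcont] := h_ri.
pose D := [set x : G | {for x, continuous h}].
have D_dense (x : G) (U : set G) : nbhs x U -> exists2 y, U y & D y.
  rewrite nbhsE => -[V [oV Vx] VU]; apply: contrapT => nD.
  have Vneg : m.-negligible (V : set (borel G)).
    by apply: negligibleS hcont => y Vy Dy; apply: nD; exists y => //; exact: VU.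
  have mV : measurable (V : set (borel G)) by exact: borel_open.
  have : 0 < fine (m V) by apply: haar_open_gt0 => //; exists x.
  by rewrite ((negligibleP m mV).1 Vneg) ltxx.
have [gR cR gRE] : exists2 g : G -> R, continuous g & forall x, D x -> g x = complex.Re (h x).
  apply: (dense_extension (M := M)) => //.
    by move=> x; apply: le_trans (normc_Re _) (hM x).
  move=> e e0.
  exact: (Re_unif_continuous_on_cont G_compact G_hausdorff m_haar P_proj Lf h_ri fh e0).
have [gI cI gIE] : exists2 g : G -> R, continuous g & forall x, D x -> g x = complex.Im (h x).
  apply: (dense_extension (M := M)) => //.
    by move=> x; apply: le_trans (normc_Im _) (hM x).
  move=> e e0; pose w : R[i] := 0 +i* (-1).
  have ReE x : complex.Re (w * h x) = complex.Im (h x).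
    by rewrite ReM /= mul0r sub0r mulN1r opprK.
  have chw x : {for x, continuous h} -> {for x, continuous (fun x => w * h x)}.
    by move=> hx; exact: (@cvgZl_tmp _ R[i] _ _ _ w _ _ hx).
  have whf : {ae m, forall x, (w *: f : Linfty m) x = w * h x}.
    by apply: ae_imp2 (Linfty_scale_ae w f) fh _ => x wf fx; rewrite [LHS]wf fx.
  have wh_ri : riemann_integrable m (fun x => w * h x).
    split; first by exists (normc w * M) => x; rewrite normcM ler_wpM2l ?normc_ge0.
    by apply: negligibleS hcont => x /= nwh hx; apply: nwh; exact: chw.
  have [W W0 unifW] := Re_unif_continuous_on_cont G_compact G_hausdorff m_haar P_proj
    (Linfty_specZ w Lf) wh_ri whf e0.
  exists W; first exact: W0.
  move=> x y Dx Dy Wxy.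
  rewrite -!ReE.
  exact: (unifW _ _ (chw _ Dx) (chw _ Dy) Wxy).
pose g x := gR x +i* gI x.
have cg : continuous g.
  by move=> x; apply/continuous_ReIm; split; [exact: cR|exact: cI].
have fg : {ae m, forall x, f x = g x}.
  have Dae : {ae m, forall x, D x} by [].
  apply: ae_imp2 fh Dae _ => x -> Dx; rewrite /g gRE// gIE//; by case: (h x).
exists g; split => // gamma nL.
have [N gN] := continuous_cess_le m G_compact cg.
by rewrite -(fourier_ae gamma (Linfty_cess_le f) gN fg) Lf.
Qed.

End riemann_integrable_functions.

(** * Almost disjoint families *)

Section branches.
Implicit Types (alpha beta : nat -> bool) (l n : nat).

Fixpoint branch_code alpha l : nat :=
  if l is k.+1 then ((branch_code alpha k).*2 + alpha k)%N else 1%N.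

Lemma branch_code_bound alpha l : (2 ^ l <= branch_code alpha l < 2 ^ l.+1)%N.
Proof.
elim: l => [//|l] /=; rewrite !expnS; move: (2 ^ l)%N (branch_code alpha l) => p c.
by case: (alpha l) => /=; lia.
Qed.

Lemma branch_code_inj alpha beta l : branch_code alpha l = branch_code beta l ->
  forall i, (i < l)%N -> alpha i = beta i.
Proof.
elim: l => [//|l IH] /= E i; have [El Ec] : alpha l = beta l /\
    branch_code alpha l = branch_code beta l.
  by move: E; case: (alpha l); case: (beta l) => /=; lia.
by rewrite ltnS leq_eqVlt => /orP[/eqP->//|]; exact: IH.
Qed.

(* The set of nodes of the branch alpha of the binary tree, a node being coded by the number
   whose binary digits are 1 followed by the turns taken to reach it. *)
Definition branch alpha n : bool := branch_code alpha (trunc_log 2 n) == n.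

Lemma branch_infinite alpha N : exists2 n, (N <= n)%N & branch alpha n.
Proof.
exists (branch_code alpha N).
  have /andP[h _] := branch_code_bound alpha N.
  by apply: leq_trans h; apply: ltnW; exact: ltn_expl.
by rewrite /branch (trunc_log_eq _ (branch_code_bound alpha N)).
Qed.

Lemma branch_disjoint alpha beta l n : alpha l != beta l -> (2 ^ l.+1 <= n)%N ->
  branch alpha n -> branch beta n -> False.
Proof.
move=> /eqP ab ln /eqP an /eqP bn; apply: ab.
apply: (@branch_code_inj _ _ (trunc_log 2 n)); first by rewrite an bn.
by apply: trunc_log_max.
Qed.

End branches.

Lemma uncountable_branches : ~ countable [set: nat -> bool].
Proof.
move=> /countable_injP[f f_inj].
pose D n := `[< forall alpha : nat -> bool, f alpha = n -> alpha n = false >].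
have DE : D (f D) = false.
  apply/negP => DfD; move/asboolP : (DfD) => /(_ D erefl); rewrite DfD//.
have : D (f D).
  by apply/asboolP => alpha fa; rewrite (f_inj alpha D)// inE.
by rewrite DE.
Qed.

Section almost_disjoint.
Variables (R : realType) (lam : nat -> (nat -> R) -> R).
Let bounded_seq (a : nat -> R) := exists M, forall n, `|a n| <= M.
Hypothesis lam_lin : forall k c a b, bounded_seq a -> bounded_seq b ->
  lam k (fun n => c * a n + b n) = c * lam k a + lam k b.
Hypothesis lam_bound : forall k, exists M, forall a, (forall n, `|a n| <= 1) ->
  lam k a <= M.
Hypothesis lam_fin : forall k a N, (forall n, (N <= n)%N -> a n = 0) -> lam k a = 0.

Let ind (B : nat -> bool) n : R := (B n)%:R.

Let ind_bounded B : bounded_seq (ind B).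
Proof. by exists 1 => n; rewrite ger0_norm ?ler0n// lern1 leq_b1. Qed.

Let lam_sum k r (s : nat -> R) (B : nat -> nat -> bool) :
  bounded_seq (fun n => \sum_(i < r) s i * ind (B i) n) /\
  lam k (fun n => \sum_(i < r) s i * ind (B i) n) = \sum_(i < r) s i * lam k (ind (B i)).
Proof.
elim: r => [|r [[M bM] IH]].
  split; first by exists 0 => n; rewrite big_ord0 normr0.
  by rewrite big_ord0; apply: (@lam_fin _ _ 0) => n _; rewrite big_ord0.
rewrite (_ : (fun n => _) =
    fun n => s r * ind (B r) n + \sum_(i < r) s i * ind (B i) n); last first.
  by apply/funext => n; rewrite big_ord_recr addrC.
split.
  exists (`|s r| + M) => n; apply: le_trans (ler_normD _ _) _; apply: lerD => //.
  by rewrite normrM ler_piMr// ger0_norm ?ler0n// lern1 leq_b1.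
rewrite lam_lin//; last by exists M.
by rewrite IH big_ord_recr/= addrC.
Qed.

Let lam_tail k B N : lam k (ind (fun n => B n && (N <= n)%N)) = lam k (ind B).
Proof.
have -> : ind (fun n => B n && (N <= n)%N) =
    fun n => -1 * ind (fun n => B n && (n < N)%N) n + ind B n.
  apply/funext => n; rewrite /ind ltnNge; case: (B n) => /=; case: (N <= n)%N => /=; ring.
rewrite lam_lin// (@lam_fin _ _ N) ?mulr0 ?add0r// => n Nn.
by rewrite /ind ltnNge Nn andbF.
Qed.

Let finite_branches k (e : R) : 0 < e ->
  finite_set [set alpha | e <= `|lam k (ind (branch alpha))|].
Proof.
move=> e0; apply: contrapT => /infiniteP/pcard_leP[u].
have uS i : e <= `|lam k (ind (branch (u i)))| by exact: (@funS _ _ _ _ u i I).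
have u_inj : injective u by move=> i j; apply: (@inj _ _ _ u); rewrite inE.
have [M lamM] := lam_bound k.
have [r rM] : exists r : nat, M < r%:R * e.
  exists (Num.bound (M / e)); rewrite -ltr_pdivrMr//.
  have [M0|M0] := leP 0 (M / e); first exact: archi_boundP.
  by apply: lt_le_trans M0 _; exact: ler0n.
have /choice[d dP] : forall p : nat * nat, exists l, p.1 != p.2 -> u p.1 l != u p.2 l.
  move=> [i j] /=; apply: contrapT => nex.
  have uij : u i = u j.
    apply/funext => l; apply/eqP; apply: contrapT => ul; apply: nex; exists l => _.
    exact/negP.
  by apply: nex; exists 0%N; rewrite (u_inj _ _ uij) eqxx.
pose L := (\max_(i < r) \max_(j < r) d (i : nat, j : nat))%N.
pose N := (2 ^ L.+1)%N.
have disj n (i j : 'I_r) : (N <= n)%N -> branch (u i) n -> branch (u j) n -> i = j.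
  move=> Nn bi bj; apply/eqP; apply: contrapT => /negP ij; have uij := dP (i : nat, j : nat) ij.
  apply: (branch_disjoint uij _ bi bj); apply: leq_trans Nn; rewrite leq_exp2l// ltnS.
  apply: leq_trans (leq_bigmax (F := fun i : 'I_r => (\max_(j < r) d (i : nat, j : nat))%N) i).
  exact: (leq_bigmax (F := fun j : 'I_r => d (i : nat, j : nat))).
pose B i n := branch (u i) n && (N <= n)%N.
pose s i := Num.sg (lam k (ind (branch (u i)))).
have [_ lamS] := lam_sum k r s B.
have : lam k (fun n => \sum_(i < r) s i * ind (B i) n) <= M.
  apply: lamM => n; have [[i Bi]|nB] := pselect (exists i : 'I_r, B i n).
    rewrite (bigD1 i)//= big1 ?addr0 => [|j ji].
      rewrite normrM /ind Bi normr1 mulr1 /s; case: sgrP; rewrite ?normr0 ?normr1 ?normrN1//.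
    rewrite /ind; case: (boolP (B j n)) => [Bj|_]; last by rewrite mulr0.
    move: Bi Bj => /andP[bi Nn] /andP[bj _]; move: ji.
    by rewrite (disj n j i Nn bj bi) eqxx.
  rewrite big1 ?normr0// => i _; rewrite /ind; case: (boolP (B i n)) => [Bi|_].
    by exfalso; apply: nB; exists i.
  by rewrite mulr0.
rewrite lamS leNgt => /negP; apply; apply: lt_le_trans rM _.
have -> : r%:R * e = \sum_(i < r) e by rewrite sumr_const card_ord mulr_natl.
apply: ler_sum => i _.
by rewrite lam_tail /s -normrEsg uS.
Qed.

Lemma almost_disjoint_null : exists B : nat -> bool,
  (forall N, exists2 n, (N <= n)%N & B n) /\ forall k, lam k (fun n => (B n)%:R) = 0.
Proof.
suff [alpha H] : exists alpha, forall k, lam k (ind (branch alpha)) = 0.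
  by exists (branch alpha); split => // N; exact: branch_infinite.
apply: contrapT => nex; apply: uncountable_branches.
have -> : [set: nat -> bool] = \bigcup_k \bigcup_j
    [set alpha | j.+1%:R^-1 <= `|lam k (ind (branch alpha))|].
  apply/seteqP; split => // alpha _.
  have [k lk] : exists k, lam k (ind (branch alpha)) != 0.
    apply: contrapT => nk; apply: nex; exists alpha => k; apply/eqP; apply: contrapT => lk.
    by apply: nk; exists k; exact/negP.
  rewrite -normr_gt0 in lk; have := @near_infty_natSinv_lt R (PosNum lk).
  by move=> [j _ jl]; exists k => //; exists j => //=; apply: ltW; exact: (jl j (leqnn j)).
apply: bigcup_countable => // k _; apply: bigcup_countable => // j _.
by apply: finite_set_countable; apply: finite_branches; rewrite invr_gt0 ltr0n.
Qed.

End almost_disjoint.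

(** * The absence of c_0 *)

Lemma normc_real (R : realType) (r : R) : normc r%:C = `|r|.
Proof. by rewrite /= expr0n /= addr0 sqrtr_sqr. Qed.

Section multipliers.
Variables (R : realType) (G : topologicalZmodType) (m : probability (borel G) R).
Hypothesis G_compact : compact [set: G].
Variables (Lambda : set (character R G)) (F : nat -> G -> R[i]) (C : R).
Hypothesis F_cont : forall n, continuous (F n).
Hypothesis F_spec : forall n gamma, ~ Lambda gamma -> fourier m (F n) gamma = 0.
Hypothesis F_sum : forall x N, \sum_(n < N) normc (F n x) <= C.

Definition partial_mult (b : nat -> R) N (x : G) : R[i] := \sum_(n < N) (b n)%:C * F n x.

Definition mult (b : nat -> R) (x : G) : R[i] :=
  (limn (fun N => complex.Re (partial_mult b N x))) +i*
  (limn (fun N => complex.Im (partial_mult b N x))).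

Definition mult_cls (b : nat -> R) : Linfty m := cls m (mult b).

Lemma Re_partial_mult b N x :
  complex.Re (partial_mult b N x) = \sum_(n < N) b n * complex.Re (F n x).
Proof.
rewrite /partial_mult (big_morph (@complex.Re R) (@ReD R) erefl).
by apply: eq_bigr => i _; rewrite ReM /= mul0r subr0.
Qed.

Lemma Im_partial_mult b N x :
  complex.Im (partial_mult b N x) = \sum_(n < N) b n * complex.Im (F n x).
Proof.
rewrite /partial_mult (big_morph (@complex.Im R) (@ImD R) erefl).
by apply: eq_bigr => i _; rewrite ImM /= mul0r addr0.
Qed.

Let abs_cvg (u v : nat -> R) (B : R) : (forall n, `|u n| <= v n) ->
  (forall N, \sum_(n < N) v n <= B) -> cvgn (fun N => \sum_(n < N) u n).
Proof.
move=> uv vB.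
have : cvgn [normed series u].
  apply: nondecreasing_is_cvgn.
    by apply: nondecreasing_series => n _ _; exact: normr_ge0.
  exists B => _ [N _ <-]; rewrite /normed_series_of seriesEord /=.
  by apply: le_trans (vB N); apply: ler_sum => i _; exact: uv.
by move=> /normed_cvg; rewrite seriesEord.
Qed.

Variables (b : nat -> R) (M : R).
Hypothesis bM : forall n, `|b n| <= M.

Let M0 : 0 <= M. Proof. exact: le_trans (normr_ge0 _) (bM 0). Qed.

Let term_le n (r : R) x : `|r| <= normc (F n x) -> `|b n * r| <= M * normc (F n x).
Proof. by move=> rF; rewrite normrM ler_pM. Qed.

Let sum_le x N : \sum_(n < N) M * normc (F n x) <= M * C.
Proof. by rewrite -mulr_sumr ler_wpM2l. Qed.

Lemma Re_partial_mult_cvg x :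
  complex.Re (partial_mult b N x) @[N --> \oo] --> complex.Re (mult b x).
Proof.
suff : cvgn (fun N => complex.Re (partial_mult b N x)) by [].
rewrite (_ : (fun N => _) = fun N => \sum_(n < N) b n * complex.Re (F n x)).
  exact: (@abs_cvg (fun n => b n * complex.Re (F n x)) (fun n => M * normc (F n x)) (M * C)
    (fun n => term_le (normc_Re _)) (sum_le x)).
by apply/funext => N; exact: Re_partial_mult.
Qed.

Lemma Im_partial_mult_cvg x :
  complex.Im (partial_mult b N x) @[N --> \oo] --> complex.Im (mult b x).
Proof.
suff : cvgn (fun N => complex.Im (partial_mult b N x)) by [].
rewrite (_ : (fun N => _) = fun N => \sum_(n < N) b n * complex.Im (F n x)).
  exact: (@abs_cvg (fun n => b n * complex.Im (F n x)) (fun n => M * normc (F n x)) (M * C)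
    (fun n => term_le (normc_Im _)) (sum_le x)).
by apply/funext => N; exact: Im_partial_mult.
Qed.

Lemma normc_partial_mult x N : normc (partial_mult b N x) <= M * C.
Proof.
apply: le_trans (sum_le x N); rewrite /partial_mult.
elim: N => [|N IH]; first by rewrite !big_ord0 normc0.
rewrite !big_ord_recr/=; apply: le_trans (le_normcD _ _) _; apply: lerD => //.
by rewrite normcM normc_real ler_wpM2r ?normc_ge0.
Qed.

Lemma cess_le_partial_mult N : cess_le m (M * C) (partial_mult b N : borel G -> R[i]).
Proof.
have cF n : cess_le m C (F n : borel G -> R[i]).
  apply: cess_leP; first exact: cmeasurable_continuous.
  apply: nearW => x; apply: le_trans (F_sum x n.+1).
  by rewrite big_ord_recr /= lerDr sumr_ge0// => i _; exact: normc_ge0.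
apply: cess_leP; last by apply: nearW => x; exact: normc_partial_mult.
elim: N => [|N [IR II]].
  rewrite (_ : partial_mult b 0 = cst 0); first by split; exact: measurable_cst.
  by apply/funext => x; rewrite /partial_mult big_ord0.
have [[mR _] [mI _]] := cF N.
split.
  rewrite (_ : (fun x => _) = fun x => complex.Re (partial_mult b N x) + b N * complex.Re (F N x)).
    by apply: measurable_funD => //; apply: measurable_funM => //; exact: measurable_cst.
  by apply/funext => x; rewrite !Re_partial_mult big_ord_recr.
rewrite (_ : (fun x => _) = fun x => complex.Im (partial_mult b N x) + b N * complex.Im (F N x)).
  by apply: measurable_funD => //; apply: measurable_funM => //; exact: measurable_cst.
by apply/funext => x; rewrite !Im_partial_mult big_ord_recr.
Qed.

Lemma cess_le_mult : cess_le m (M * C) (mult b : borel G -> R[i]).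
Proof.
have cP N := cess_le_partial_mult N.
have bR x N : `|complex.Re (partial_mult b N x)| <= M * C.
  by apply: le_trans (normc_Re _) (normc_partial_mult x N).
have bI x N : `|complex.Im (partial_mult b N x)| <= M * C.
  by apply: le_trans (normc_Im _) (normc_partial_mult x N).
split; split.
- have mN N : measurable_fun [set: borel G] (fun x : borel G => complex.Re (partial_mult b N x)).
    by case: (cP N) => -[].
  by apply: (measurable_fun_cvg mN) => x _; exact: Re_partial_mult_cvg.
- by apply: nearW => x; exact: (cvg_normr_le (@Re_partial_mult_cvg x) (bR x)).
- have mN N : measurable_fun [set: borel G] (fun x : borel G => complex.Im (partial_mult b N x)).
    by case: (cP N) => _ [].
  by apply: (measurable_fun_cvg mN) => x _; exact: Im_partial_mult_cvg.
- by apply: nearW => x; exact: (cvg_normr_le (@Im_partial_mult_cvg x) (bI x)).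
Qed.

Lemma mult_cls_ae : {ae m, forall x, mult_cls b x = mult b x}.
Proof. exact: cls_ae cess_le_mult. Qed.

Lemma nrm_mult_cls : nrm (mult_cls b) <= 2 * (M * C).
Proof.
have [[_ h1] [_ h2]] := cess_le_mult; apply: nrm_le.
apply: ae_imp2 mult_cls_ae (ae_imp2 h1 h2 (fun x a b => conj a b)) _ => x -> [a1 a2].
by apply: le_trans (normc_le_ReIm _) _; rewrite mulr_natl mulr2n lerD.
Qed.

Lemma C_spec_F n : C_spec m Lambda (cls m (F n)).
Proof. by apply: C_spec_cls => //; exact: F_spec. Qed.

Lemma partial_mult_ae N :
  {ae m, forall x, (\sum_(n < N) (b n)%:C *: cls m (F n) : Linfty m) x = partial_mult b N x}.
Proof.
apply: (Linfty_sum_ae N (F := fun n => (b n)%:C *: cls m (F n))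
  (k := fun n x => (b n)%:C * F n x)) => n.
have [L cF] := continuous_cess_le m G_compact (@F_cont n).
apply: ae_imp2 (Linfty_scale_ae (b n)%:C (cls m (F n))) (cls_ae cF) _ => x bx Fx.
by rewrite [LHS]bx Fx.
Qed.

Lemma Rintegral_partial_mult (D : set (borel G)) N : measurable D ->
  \int[m]_(x in D) complex.Re (partial_mult b N x) =
  \sum_(n < N) b n * \int[m]_(x in D) complex.Re (F n x).
Proof.
move=> mD.
rewrite -(intRe_ae mD (cess_le_measurable (cess_le_partial_mult N)) (partial_mult_ae N)).
rewrite (intRe_sum N b (fun n => cls m (F n)) mD); apply: eq_bigr => i _.
have [L cF] := continuous_cess_le m G_compact (@F_cont i).
by rewrite (intRe_ae mD (cess_le_measurable cF) (cls_ae cF)).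
Qed.

Lemma intRe_mult_cls (D : set (borel G)) : measurable D ->
  \sum_(n < N) b n * \int[m]_(x in D) complex.Re (F n x) @[N --> \oo] -->
  intRe D (mult_cls b).
Proof.
move=> mD; rewrite (intRe_ae mD (cess_le_measurable cess_le_mult) mult_cls_ae).
have -> : (fun N => \sum_(n < N) b n * \int[m]_(x in D) complex.Re (F n x)) =
    (fun N => \int[m]_(x in D) complex.Re (partial_mult b N x)).
  by apply/funext => N; rewrite Rintegral_partial_mult.
apply: (@Rintegral_bounded_cvg _ _ _ m (M * C)) => //.
- by move=> N; case: (cess_le_partial_mult N) => -[].
- by move=> N x; apply: le_trans (normc_Re _) (normc_partial_mult x N).
- exact: Re_partial_mult_cvg.
Qed.

Lemma Linfty_spec_mult_cls : Linfty_spec m Lambda (mult_cls b).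
Proof.
apply: Linfty_spec_cls cess_le_mult _ => gamma nL.
have f0 N : fourier m (partial_mult b N) gamma = 0.
  rewrite -(fourier_ae gamma (Linfty_cess_le _) (cess_le_partial_mult N) (partial_mult_ae N)).
  exact: (Linfty_spec_sum N (fun n => (b n)%:C)
    (fun n => C_spec_Linfty_spec G_compact (C_spec_F n)) nL).
have lim (r : R[i] -> R) : (forall N, \int[m]_x r (partial_mult b N x * (gamma x)^*%C) = 0) ->
    (forall N, measurable_fun [set: borel G]
      (fun x : borel G => r (partial_mult b N x * (gamma x)^*%C))) ->
    (forall z, `|r z| <= normc z) ->
    (forall x, r (partial_mult b N x * (gamma x)^*%C) @[N --> \oo] -->
       r (mult b x * (gamma x)^*%C)) ->
    \int[m]_x r (mult b x * (gamma x)^*%C) = 0.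
  move=> r0 mr rle rcvg.
  have := @Rintegral_bounded_cvg _ _ _ m (M * C) _ _ setT measurableT mr _ rcvg.
  have rb N x : `|r (partial_mult b N x * (gamma x)^*%C)| <= M * C.
    apply: le_trans (rle _) _; rewrite normcM normc_conj normc_character mulr1.
    exact: normc_partial_mult.
  move=> /(_ rb) /cvg_lim <- //.
  by under eq_fun do rewrite r0; rewrite lim_cst.
have mf N := cess_le_fourier gamma (cess_le_partial_mult N).
rewrite /fourier /cintegral; apply/eqP; rewrite eq_complex /=; apply/andP; split; apply/eqP.
- apply: lim; [by move=> N; case: (f0 N)|by move=> N; case: (mf N) => -[]|exact: normc_Re|].
  move=> x; rewrite ReM; under eq_fun do rewrite ReM.
  apply: cvgB; apply: cvgMl.
    exact: Re_partial_mult_cvg.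
  exact: Im_partial_mult_cvg.
- apply: lim; [by move=> N; case: (f0 N)|by move=> N; case: (mf N) => _ []|exact: normc_Im|].
  move=> x; rewrite ImM; under eq_fun do rewrite ImM.
  apply: cvgD; apply: cvgMl.
    exact: Re_partial_mult_cvg.
  exact: Im_partial_mult_cvg.
Qed.

Lemma mult_cls_fin N : (forall n, (N <= n)%N -> b n = 0) ->
  mult_cls b = \sum_(n < N) (b n)%:C *: cls m (F n).
Proof.
move=> b0.
have stat k x : (N <= k)%N -> partial_mult b k x = partial_mult b N x.
  elim: k => [|k IH]; first by rewrite leqn0 => /eqP ->.
  rewrite leq_eqVlt => /orP[/eqP <-//|Nk].
  by rewrite /partial_mult big_ord_recr/= b0// mul0r addr0; exact: IH.
have E x : mult b x = partial_mult b N x.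
  apply/eqP; rewrite eq_complex; apply/andP; split; apply/eqP.
    apply: cvg_lim => //; apply: cvg_near_cst; exists N => // k /= Nk; by rewrite stat.
  apply: cvg_lim => //; apply: cvg_near_cst; exists N => // k /= Nk; by rewrite stat.
apply/Linfty_eqP; apply: ae_imp2 mult_cls_ae (partial_mult_ae N) _ => x -> ->.
exact: E.
Qed.

End multipliers.

Lemma cvg_ge_nat (R : realType) (u : nat -> R) (l B : R) N :
  u n @[n --> \oo] --> l -> (forall n, (N <= n)%N -> B <= u n) -> B <= l.
Proof. by move=> ul uB; apply: cvgr_to_ge ul _; exists N. Qed.

Section phillips.
Variables (R : realType) (G : topologicalZmodType) (m : probability (borel G) R).
Hypothesis G_compact : compact [set: G].
Hypothesis m_haar : is_haar m.
Variables (Lambda : set (character R G)) (P : Linfty m -> Linfty m).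
Hypothesis P_proj : bounded_projection (Linfty_spec m Lambda) (C_spec m Lambda) P.
Variables (F : nat -> G -> R[i]) (C : R).
Hypothesis F_cont : forall n, continuous (F n).
Hypothesis F_spec : forall n gamma, ~ Lambda gamma -> fourier m (F n) gamma = 0.
Hypothesis F_sum : forall x N, \sum_(n < N) normc (F n x) <= C.

Lemma mult_cls_lin (c : R) (a b : nat -> R) M N : (forall n, `|a n| <= M) ->
  (forall n, `|b n| <= N) ->
  mult_cls m F (fun n => c * a n + b n) = c%:C *: mult_cls m F a + mult_cls m F b.
Proof.
move=> aM bN.
have cabM n : `|c * a n + b n| <= `|c| * M + N.
  by apply: le_trans (ler_normD _ _) _; rewrite lerD// normrM ler_wpM2l.
have E x : mult F (fun n => c * a n + b n) x = c%:C * mult F a x + mult F b x.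
  have partE k : partial_mult F (fun n => c * a n + b n) k x =
      c%:C * partial_mult F a k x + partial_mult F b k x.
    rewrite /partial_mult mulr_sumr -big_split; apply: eq_bigr => i _.
    by rewrite rmorphD rmorphM mulrDl mulrA.
  have ReE k : complex.Re (partial_mult F (fun n => c * a n + b n) k x) =
      c * complex.Re (partial_mult F a k x) + complex.Re (partial_mult F b k x).
    by rewrite partE ReD ReM /= mul0r subr0.
  have ImE k : complex.Im (partial_mult F (fun n => c * a n + b n) k x) =
      c * complex.Im (partial_mult F a k x) + complex.Im (partial_mult F b k x).
    by rewrite partE ImD ImM /= mul0r addr0.
  apply/eqP; rewrite eq_complex; apply/andP; split; apply/eqP.
    rewrite ReD ReM /= mul0r subr0; apply: cvg_lim => //.
    under eq_fun do rewrite ReE.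
    apply: cvgD; last exact: (Re_partial_mult_cvg F_sum bN).
  apply: cvgM; [exact: cvg_cst|exact: (Re_partial_mult_cvg F_sum aM)].
  rewrite ImD ImM /= mul0r addr0; apply: cvg_lim => //.
  under eq_fun do rewrite ImE.
  apply: cvgD; last exact: (Im_partial_mult_cvg F_sum bN).
  apply: cvgM; [exact: cvg_cst|exact: (Im_partial_mult_cvg F_sum aM)].
have ac : {ae m, forall x, (c%:C *: mult_cls m F a : Linfty m) x = c%:C * mult F a x}.
  apply: ae_imp2 (Linfty_scale_ae c%:C (mult_cls m F a)) (mult_cls_ae m F_cont F_sum aM) _.
  by move=> x ax aE; rewrite [LHS]ax aE.
apply/Linfty_eqP.
apply: ae_imp2 (mult_cls_ae m F_cont F_sum cabM)
  (ae_imp2 (LinftyD_ae (c%:C *: mult_cls m F a) (mult_cls m F b))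
    (ae_imp2 ac (mult_cls_ae m F_cont F_sum bN) (fun x u v => conj u v))
    (fun x u v => conj u v)) _.
move=> x h1 [h2 [h3 h4]].
exact: etrans h1 (etrans (E x) (esym (etrans h2 (congr2 +%R h3 h4)))).
Qed.

Variables (V U : nat -> set G) (x y : nat -> G) (delta : R).
Hypothesis delta0 : 0 < delta.
Hypothesis V_closure : forall i, closure (V i.+1) `<=` V i.
Hypothesis V_xy : forall i, V i (x i - y i).
Hypothesis U_open : forall i, open (U i).
Hypothesis U0 : forall i, U i !=set0.
Hypothesis U_addl : forall i z, (forall j, V j z) -> [set u | U i (z + u)] = U i.

Definition shift_diff (A : set G) (a b : G) (r : G -> R[i]) : R :=
  \int[m]_(z in shift_set A a) complex.Re (r z) - \int[m]_(z in shift_set A b) complex.Re (r z).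

Hypothesis diag : forall i,
  3 / 4 * delta * fine (m (U i)) <= shift_diff (U i) (x i) (y i) (F i).
Hypothesis off_diag : forall i N,
  \sum_(j < N | (j : nat) != i) `|shift_diff (U i) (x i) (y i) (F j)| <=
    delta / 4 * fine (m (U i)).

Lemma phillips_contradiction : False.
Proof.
have mS (A : set G) a : open A -> measurable (shift_set A a).
  by move=> oA; apply: borel_addl_set; exact: borel_open.
pose psi i (g : Linfty m) : R := intRe (shift_set (U i) (x i)) g - intRe (shift_set (U i) (y i)) g.
have psi_lin i (c : R) g1 g2 : psi i (c%:C *: g1 + g2) = c * psi i g1 + psi i g2.
  by rewrite /psi !intReD ?intReZ//; [ring|exact: mS..].
have psi0 i : psi i 0 = 0.
  by have := psi_lin i (-1) 0 0; rewrite scaler0 addr0 mulN1r addNr.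
have psi_le i g : psi i g <= 2 * nrm g.
  apply: le_trans (ler_norm _) _; apply: le_trans (ler_normB _ _) _.
  by rewrite mulr_natl mulr2n lerD// intRe_le//; exact: mS.
pose lam i (b : nat -> R) := psi i (defect P (mult_cls m F b)).
have [K K0 defK] := defect_bounded P_proj.
have Lmult b M bM := @Linfty_spec_mult_cls _ _ m G_compact Lambda F C F_cont F_spec F_sum b M bM.
have C0 : 0 <= C by apply: le_trans (F_sum 0 0); rewrite big_ord0.
have [B [Binf lamB]] : exists B : nat -> bool,
    (forall N, exists2 n, (N <= n)%N & B n) /\ forall k, lam k (fun n => (B n)%:R) = 0.
  apply: almost_disjoint_null => [i c a b [M aM] [N bN]|i|i a N aN].
  - rewrite /lam (mult_cls_lin c aM bN) (defect_lin P_proj) ?psi_lin//.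
      exact: Lmult aM.
    exact: Lmult bN.
  - exists (2 * (K * (2 * (1 * C)))) => a a1; apply: le_trans (psi_le _ _) _.
    rewrite ler_pM2l//; apply: le_trans (defK _ (Lmult _ _ a1)) _.
    by rewrite ler_wpM2l//; exact: nrm_mult_cls a1.
  - have aM n : `|a n| <= \sum_(j < N) `|a j|.
      have [Nn|nN] := leqP N n; first by rewrite aN// normr0 sumr_ge0.
      by rewrite (bigD1 (Ordinal nN))//= lerDl sumr_ge0.
    have CF n := C_spec_F G_compact F_cont F_spec n.
    have LF n : Linfty_spec m Lambda (cls m (F n)) by exact: C_spec_Linfty_spec (CF n).
    rewrite /lam (mult_cls_fin m G_compact F_cont F_sum aM aN).
    rewrite (defect_sum P_proj N (fun n => (a n)%:C) LF) big1 => [|n _].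
      exact: psi0.
    by rewrite (defect_C P_proj (CF n)) scaler0.
pose b n : R := (B n)%:R.
have b1 n : `|b n| <= 1 by rewrite ger0_norm ?ler0n// lern1 leq_b1.
have [p [cp Pp _]] := C_P P_proj (Lmult _ _ b1).
have [M [pM _]] := continuous_cess_le m G_compact cp.
have d4 : 0 < delta / 4 by rewrite divr_gt0.
have [i Bi merge] := averages_merge G_compact m_haar cp V_closure V_xy U_open U_addl
  (B := [set n | B n]) Binf d4.
have psiE : psi i (mult_cls m F b) = \int[m]_(u in U i) complex.Re (p (x i + u)) -
    \int[m]_(u in U i) complex.Re (p (y i + u)).
  have := lamB i; rewrite /lam /defect -scaleN1r addrC -[-1](rmorphN1 (real_complex R)).
  rewrite psi_lin mulN1r => /eqP; rewrite addrC subr_eq0 => /eqP ->.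
  rewrite /psi (intRe_ae (mS _ _ (U_open i)) (cmeasurable_continuous cp) Pp).
  rewrite (intRe_ae (mS _ _ (U_open i)) (cmeasurable_continuous cp) Pp).
  by rewrite !(Rintegral_shift_set m_haar _ (U_open i) pM).
have lim1 := intRe_mult_cls (m := m) G_compact F_cont F_sum b1 (mS _ (x i) (U_open i)).
have lim2 := intRe_mult_cls (m := m) G_compact F_cont F_sum b1 (mS _ (y i) (U_open i)).
have lim := cvgB lim1 lim2; rewrite -/(psi i _) psiE in lim.
have mU0 : 0 < fine (m (U i)) by exact: haar_open_gt0.
have : delta / 2 * fine (m (U i)) <= \int[m]_(u in U i) complex.Re (p (x i + u)) -
    \int[m]_(u in U i) complex.Re (p (y i + u)).
  apply: (cvg_ge_nat (N := i.+1) (lim _)) => N iN.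
  rewrite /= -sumrB (bigD1 (Ordinal iN))//=.
  have -> : b i = 1 by rewrite /b Bi.
  rewrite !mul1r -/(shift_diff _ _ _ _).
  have := diag i; have := off_diag i N.
  have : `|\sum_(j < N | j != Ordinal iN)
      (b j * \int[m]_(z in shift_set (U i) (x i)) complex.Re (F j z) -
      b j * \int[m]_(z in shift_set (U i) (y i)) complex.Re (F j z))| <=
      \sum_(j < N | (j : nat) != i) `|shift_diff (U i) (x i) (y i) (F j)|.
    apply: le_trans (ler_norm_sum _ _ _) _; rewrite (eq_bigl (fun j : 'I_N => (j : nat) != i))//.
    by apply: ler_sum => j _; rewrite -mulrBr normrM -[leRHS]mul1r ler_wpM2r.
  rewrite ler_norml => /andP[h1 _] h2 h3; lra.
move: merge; rewrite ler_norml => /andP[_ h1] h2.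
have := le_trans h2 h1; rewrite ler_pM2r//; lra.
Qed.

End phillips.

Section sums.
Variables (R : realType) (v : nat -> R).
Hypothesis v0 : forall n, 0 <= v n.

Lemma sum_tail_small (B e : R) : (forall N, \sum_(n < N) v n <= B) -> 0 < e ->
  exists K, forall k N, (K <= k)%N -> \sum_(k <= n < N) v n <= e.
Proof.
move=> vB e0; pose S := range (fun N => \sum_(n < N) v n).
have hsS : has_sup S.
  by split; [exists (\sum_(n < 0) v n), 0%N|exists B => _ [N _ <-]].
have [_ [K _ <-] supK] := sup_adherent e0 hsS.
exists K => k N Kk; have [Nk|kN] := leqP N k; first by rewrite big_geq// ltW.
have supN : \sum_(n < N) v n <= sup S by apply: sup_upper_bound => //; exists N.
have : \sum_(n < K) v n <= \sum_(n < k) v n.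
  rewrite -!(big_mkord xpredT v) (big_cat_nat (leq0n K) Kk)/= lerDl.
  by apply: sumr_ge0 => n _.
move: supN; rewrite -!(big_mkord xpredT v) (big_cat_nat (leq0n k) (ltnW kN))/=.
rewrite -(big_mkord xpredT v) in supK; lra.
Qed.

Lemma sum_subseq_le (s : nat -> nat) i N : (forall j, (s j < s j.+1)%N) -> (i <= N)%N ->
  \sum_(i <= j < N) v (s j) <= \sum_(s i <= n < s N) v n.
Proof.
move=> sS; elim: N => [|N IH]; first by rewrite leqn0 => /eqP ->; rewrite !big_geq.
rewrite leq_eqVlt => /orP[/eqP ->|]; first by rewrite !big_geq.
rewrite ltnS => iN; rewrite big_nat_recr//=.
have siN : (s i <= s N)%N.
  elim: N iN {IH} => [|N IH]; first by rewrite leqn0 => /eqP ->.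
  rewrite leq_eqVlt => /orP[/eqP ->//|/IH h]; exact: leq_trans h (ltnW (sS N)).
rewrite (big_cat_nat siN (ltnW (sS N)))/=; apply: lerD; first exact: IH.
by rewrite big_ltn// lerDl sumr_ge0.
Qed.

Lemma sum_off_diag_le i N : \sum_(j < N | (j : nat) != i) v j <=
  \sum_(0 <= j < i) v j + \sum_(i.+1 <= j < N) v j.
Proof.
rewrite -(big_mkord (fun j => j != i) v).
have [Ni|iN] := leqP N i.
  rewrite (big_cat_nat (leq0n N) Ni)/= -addrA.
  have -> : \sum_(0 <= j < N | j != i) v j = \sum_(0 <= j < N) v j.
    rewrite big_nat_cond [RHS]big_nat_cond; apply: eq_bigl => j.
    by case: (leqP 0 j) => //= _; case: ltnP => //= jN; rewrite ltn_eqF// (leq_trans jN).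
  by rewrite lerDl addr_ge0// sumr_ge0.
rewrite (big_cat_nat (leq0n i) (ltnW iN))/=; apply: lerD.
  by rewrite big_mkcond; apply: ler_sum => j _; case: ifP.
by rewrite big_ltn_cond// eqxx/= big_mkcond; apply: ler_sum => j _; case: ifP.
Qed.

End sums.

Section spread.
Variables (R : realType) (G : topologicalZmodType) (m : probability (borel G) R).
Hypothesis G_compact : compact [set: G].
Hypothesis m_haar : is_haar m.

Lemma shift_diff_le (A : set G) (a b : G) (f : G -> R[i]) c : continuous f -> open A ->
  (forall u, A u -> normc (f (a + u) - f (b + u)) <= c) ->
  `|shift_diff m A a b f| <= c * fine (m A).
Proof.
move=> cf oA fc; have [M [fM _]] := continuous_cess_le m G_compact cf.
have mA : measurable (A : set (borel G)) by exact: borel_open.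
rewrite /shift_diff (Rintegral_shift_set m_haar _ oA fM) (Rintegral_shift_set m_haar _ oA fM).
have fa := ess_le_addl m_haar a fM; have fb := ess_le_addl m_haar b fM.
rewrite -RintegralB//; [|exact: ess_le_integrable fa|exact: ess_le_integrable fb].
apply: ae_norm_Rintegral_le => //; first by have [] := ess_leB fa fb.
by apply: nearW => u Au; rewrite -ReB; apply: le_trans (normc_Re _) (fc u Au).
Qed.

Lemma Rintegral_shift_set_le (A : set G) (a : G) (f : G -> R[i]) c : continuous f -> open A ->
  (forall u, A u -> normc (f a - f (a + u)) <= c) ->
  `|complex.Re (f a) * fine (m A) - \int[m]_(z in shift_set A a) complex.Re (f z)|
    <= c * fine (m A).
Proof.
move=> cf oA fc; have [M [fM _]] := continuous_cess_le m G_compact cf.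
rewrite (Rintegral_shift_set m_haar _ oA fM).
apply: (Rintegral_addl_near_cst m_haar oA fM); apply: nearW => u Au.
by rewrite -ReB; apply: le_trans (normc_Re _) (fc u Au).
Qed.

Variables (F : nat -> G -> R[i]) (C : R).
Hypothesis F_cont : forall n, continuous (F n).
Hypothesis F_sum : forall x N, \sum_(n < N) normc (F n x) <= C.

Lemma sum_shift_diff_le (A : set G) (a b : G) N : open A ->
  \sum_(n < N) `|shift_diff m A a b (F n)| <= 2 * C * fine (m A).
Proof.
move=> oA; have mA : measurable (A : set (borel G)) by exact: borel_open.
pose s n := Num.sg (shift_diff m A a b (F n)).
have s1 n : `|s n| <= 1 by rewrite /s; case: sgrP; rewrite ?normr0 ?normr1 ?normrN1.
have mS c : measurable (shift_set A c) by exact: borel_addl_set.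
have mSE c : fine (m (shift_set A c)) = fine (m A).
  by congr fine; exact: (haar_addl m_haar (- c) mA).
have partC c : `|\int[m]_(z in shift_set A c) complex.Re (partial_mult F s N z)| <= C * fine (m A).
  rewrite -(mSE c); apply: ae_norm_Rintegral_le => //.
    by case: (cess_le_partial_mult m F_cont F_sum s1 N) => -[].
  apply: nearW => z _; apply: le_trans (normc_Re _) _.
  by rewrite -[C]mul1r; exact: (normc_partial_mult F_sum s1).
have -> : \sum_(n < N) `|shift_diff m A a b (F n)| =
    \int[m]_(z in shift_set A a) complex.Re (partial_mult F s N z) -
    \int[m]_(z in shift_set A b) complex.Re (partial_mult F s N z).
  rewrite (Rintegral_partial_mult m G_compact F_cont F_sum s1 N (mS a)).
  rewrite (Rintegral_partial_mult m G_compact F_cont F_sum s1 N (mS b)).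
  rewrite -sumrB; apply: eq_bigr => n _.
  by rewrite -mulrBr -/(shift_diff m A a b (F n)) /s -normrEsg.
apply: le_trans (ler_norm _) _; apply: le_trans (ler_normB _ _) _.
by rewrite -mulrA mulr_natl mulr2n lerD.
Qed.

Variables (Lambda : set (character R G)) (P : Linfty m -> Linfty m).
Hypothesis P_proj : bounded_projection (Linfty_spec m Lambda) (C_spec m Lambda) P.
Hypothesis F_spec : forall n gamma, ~ Lambda gamma -> fourier m (F n) gamma = 0.

Lemma no_spread_sequence (delta : R) : 0 < delta ->
  (forall n, exists x, delta <= complex.Re (F n x)) -> False.
Proof.
move=> delta0 /choice[x xP]; pose e := delta / 16.
have e0 : 0 < e by rewrite divr_gt0.
have eS n : 0 < e / n.+1%:R by rewrite divr_gt0// ltr0n.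
pose A (n : nat) (W : set G) := [set v | forall j, (j < n.+1)%N -> forall z,
  normc (F j z - F j (z + v)) <= e / n.+1%:R].
have A0 n W : nbhs 0 W -> nbhs 0 (A n W).
  move=> _; rewrite /A; move: (eS n); move: (e / _) => d d0.
  elim: n.+1 => [|k IH]; first by apply: nearW => v j.
  have := compact_unif_continuous G_compact (fun x _ => @F_cont k x) d0.
  apply: filterS2 IH => v vk Fk j; rewrite ltnS leq_eqVlt => /orP[/eqP -> z|jk].
    exact: Fk.
  exact: vk.
have [V' [V'chain V'A]] := nbhs_chain_ex A0.
pose V i := V' i.+1.
have Vchain : nbhs_chain V by split=> [i|i]; [exact: V'chain.1|exact: V'chain.2].
have VF k v j z : V k v -> (j <= k)%N -> normc (F j z - F j (z + v)) <= e / k.+1%:R.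
  move=> Vv jk; have [_ V0 _] := V'chain.1 k.+1; rewrite -[v]addr0.
  by apply: (V'A k v 0 Vv V0).
pose U := core_nbhs V.
have oU i : open (U i) by exact: open_core_nbhs.
have U0 i : U i 0 by exact: core_nbhs0.
have UV i : U i `<=` V i by apply: core_nbhs_sub_add => //; exact: Vchain.2.
have mU0 i : 0 < fine (m (U i)) by apply: haar_open_gt0 => //; exists 0.
have [x0 [_ x0c]] : [set: G] `&` cluster (x @ \oo) !=set0.
  by apply: G_compact; exact: filterT.
have x0P W N : nbhs x0 W -> exists2 k, (N <= k)%N & W (x k).
  move=> Wx0; have [_ [[k Nk <-] Wk]] := x0c (x @` [set k | (N <= k)%N]) W
    (ex_intro2 _ _ N I (fun k Nk => ex_intro2 _ _ k Nk erefl)) Wx0.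
  by exists k.
pose a k n := `|shift_diff m (U k) (x k) x0 (F n)|.
have /choice[next nextP] : forall k, exists k', [/\ (k < k')%N, V k (x k' - x0),
    forall N, \sum_(k' <= n < N) a k n <= e * fine (m (U k)) &
    normc (F k' x0) <= e].
  move=> k; have emu : 0 < e * fine (m (U k)) by rewrite mulr_gt0.
  have [K1 K1P] := @sum_tail_small _ (a k) (fun n => normr_ge0 _) _ _
    (fun N => sum_shift_diff_le (x k) x0 N (oU k)) emu.
  have [K2 K2P] := @sum_tail_small _ (fun n => normc (F n x0)) (fun n => normc_ge0 _) _ _
    (F_sum x0) e0.
  have Vx0 : nbhs x0 [set y | V k (- x0 + y)].
    have [oV V0 _] := Vchain.1 k.
    by apply: open_nbhs_nbhs; split; [exact: open_addl|rewrite /= addNr].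
  have [k' k'P Vk'] := x0P _ (maxn k.+1 (maxn K1 K2)) Vx0.
  move: k'P; rewrite !geq_max => /andP[kk' /andP[K1k' K2k']].
  exists k'; split => //.
  - by rewrite addrC.
  - by move=> N; exact: K1P.
  - by have := K2P k' k'.+1 K2k'; rewrite big_nat1.
pose s i := iter i next 0%N.
have sS i : (s i < s i.+1)%N by have [] := nextP (s i).
have sle i j : (i <= j)%N -> (s i <= s j)%N.
  elim: j => [|j IH]; first by rewrite leqn0 => /eqP ->.
  by rewrite leq_eqVlt => /orP[/eqP ->//|/IH h]; exact: leq_trans h (ltnW (sS j)).
have sge i : (i <= s i)%N by elim: i => // i IH; exact: leq_ltn_trans IH (sS i).
pose k i := s i.+1.
have F'sum z N : \sum_(j < N) normc (F (k j) z) <= C.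
  apply: le_trans (F_sum z (k N)); rewrite -(big_mkord xpredT (fun j => normc (F (k j) z))).
  rewrite -(big_mkord xpredT (fun n => normc (F n z))).
  have := @sum_subseq_le _ (fun n => normc (F n z)) (fun n => normc_ge0 _) k 0 N
    (fun j => sS j.+1) (leq0n N).
  move=> /le_trans; apply; rewrite [leRHS](big_cat_nat (leq0n (k 0)) (sle 1 N.+1 isT))/=.
  by rewrite lerDr sumr_ge0// => n _; exact: normc_ge0.
have Vk i v : V (k i) v -> forall z, normc (F (k i) z - F (k i) (z + v)) <= e.
  move=> Vv z; apply: le_trans (VF _ _ _ z Vv (leqnn _)) _.
  by rewrite ler_pdivrMr ?ltr0n// -[leLHS]mulr1 ler_pM2l// ler1n.
apply: (@phillips_contradiction _ _ m G_compact m_haar Lambda P P_proj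
  (fun i => F (k i)) C (fun i => @F_cont (k i)) (fun i => F_spec (k i)) F'sum
  (fun i => V (s i)) (fun i => U (k i)) (fun i => x (k i)) (fun=> x0) delta delta0).
- move=> i; apply: (subset_trans _ (nbhs_chain_closure Vchain (i := s i))).
  by apply: closure_subset; exact: nbhs_chain_le (sS i).
- by move=> i; have [] := nextP (s i).
- by move=> i; exact: oU.
- by move=> i; exists 0.
- move=> i z Vz; apply: (core_nbhs_addl Vchain) => j.
  exact: (nbhs_chain_le Vchain (sge j) (Vz j)).
- move=> i; have [_ _ _ Fx0] := nextP (s i).
  have h1 := Rintegral_shift_set_le (a := x (k i)) (@F_cont (k i)) (oU (k i))
    (fun u Uu => Vk i u (UV _ _ Uu) (x (k i))).
  have h2 := Rintegral_shift_set_le (a := x0) (@F_cont (k i)) (oU (k i))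
    (fun u Uu => Vk i u (UV _ _ Uu) x0).
  have h3 : complex.Re (F (k i) x0) <= e.
    by apply: le_trans (ler_norm _) (le_trans (normc_Re _) Fx0).
  move: h1 h2; rewrite !ler_norml => /andP[_ h1] /andP[h2 _].
  rewrite /shift_diff /=; have := xP (k i); have := mU0 (k i).
  move: (fine (m (U (k i)))) h1 h2 => mu h1 h2 mu0 xk.
  have := ler_wpM2r (ltW mu0) h3; have := ler_wpM2r (ltW mu0) xk.
  move: h1 h2; have := mulr_gt0 delta0 mu0; rewrite /e; lra.
- move=> i N; apply: le_trans (sum_off_diag_le (v := fun j => a (k i) (k j)) _ i N) _.
    by move=> n; exact: normr_ge0.
  have [_ Vxk _ _] := nextP (s i).
  have mu0 := mU0 (k i).
  have low : \sum_(0 <= j < i) a (k i) (k j) <= e * fine (m (U (k i))).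
    apply: (@le_trans _ _ (\sum_(0 <= j < i) e / (s i).+1%:R * fine (m (U (k i))))).
      apply: ler_sum_nat => j /andP[_ ji]; apply: shift_diff_le => // u _.
      have := VF _ _ (k j) (x0 + u) Vxk (sle _ _ ji).
      have -> : x0 + u + (x (k i) - x0) = x (k i) + u.
        by rewrite addrC addrA subrK.
      by rewrite -normcN opprB.
    rewrite sumr_const_nat subn0 -mulrnAl ler_pM2r// -mulr_natr mulrAC.
    rewrite ler_pdivrMr ?ltr0n// ler_pM2l// ler_nat; exact: leq_trans (sge i) (leqnSn _).
  have high : \sum_(i.+1 <= j < N) a (k i) (k j) <= e * fine (m (U (k i))).
    have [Ni|iN] := leqP N i.+1; first by rewrite big_geq// mulr_ge0// ltW.
    have := @sum_subseq_le _ (a (k i)) (fun n => normr_ge0 _) k i.+1 N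
      (fun j => sS j.+1) (ltnW iN).
    by move=> /le_trans; apply; have [_ _ + _] := nextP (k i); apply.
  by apply: le_trans (lerD low high) _; have := mulr_gt0 delta0 mu0; rewrite /e; lra.
Qed.

End spread.

Section c0_basis.
Variable R : realType.

Lemma null_seq_unit n : (fun k => (k == n)%:R : R[i]) \in @null_seq R.
Proof.
rewrite inE /=; apply: cvg_near_cst; exists n.+1 => // k /= nk.
by rewrite gtn_eqF.
Qed.

Definition c0_unit n : c0 R := C0 (null_seq_unit n).

Lemma c0_sum_unit (c : nat -> R[i]) N k :
  (\sum_(n < N) c n *: c0_unit n : c0 R) k = if (k < N)%N then c k else 0.
Proof.
elim: N => [|N IH]; first by rewrite big_ord0.
rewrite big_ord_recr.
transitivity ((\sum_(n < N) c n *: c0_unit n : c0 R) k + c N * (k == N)%:R); first by [].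
rewrite IH [in RHS]ltnS [in RHS]leq_eqVlt; case: eqVneq => [->|kN].
  by rewrite ltnn /= add0r mulr1.
by rewrite /= mulr0 addr0.
Qed.

Lemma c0_nrmE (u : c0 R) : `|u| = (c0_sup u)%:C.
Proof. by []. Qed.

Lemma nbhs0_real_ball (V : normedModType R[i]) (A : set V) : nbhs 0 A ->
  exists2 r : R, 0 < r & forall v, `|v| < r%:C -> A v.
Proof.
move=> /nbhs_normP[r /= r0 rA]; exists (complex.Re r).
  by move: r0; case: r {rA} => a b; rewrite ltcE /= => /andP[].
move=> v vr; apply: rA; rewrite /ball_ /= sub0r normrN.
suff -> : r = (complex.Re r)%:C by [].
by move: r0; case: r {vr} => a b; rewrite ltcE /= => /andP[/eqP ->].
Qed.

End c0_basis.

Section c0_embedding.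
Variables (R : realType) (G : topologicalZmodType) (m : probability (borel G) R).
Hypothesis G_compact : compact [set: G].
Hypothesis m_haar : is_haar m.

Lemma continuous_normc_le (g : G -> R[i]) B : continuous g ->
  {ae m, forall x, normc (g x) <= B} -> forall x, normc (g x) <= B.
Proof.
move=> cg gB x; rewrite leNgt; apply/negP => Bx.
have : nbhs x [set y | B < normc (g y)].
  have d0 : 0 < normc (g x) - B by rewrite subr_gt0.
  have := (continuous_normcP _ _).1 (cg x) _ d0; apply: filterS => y h.
  have : normc (g x) <= normc (g x - g y) + normc (g y).
    by rewrite -{1}(subrK (g y) (g x)); exact: le_normcD.
  by rewrite /=; lra.
rewrite nbhsE => -[V [oV Vx] VB].
have mV : measurable (V : set (borel G)) by exact: borel_open.
have Vneg : m.-negligible (V : set (borel G)).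
  by apply: negligibleS gB => y /VB /= By gy; rewrite ltNge gy in By.
have : 0 < fine (m V) by apply: haar_open_gt0 => //; exists x.
by rewrite ((negligibleP m mV).1 Vneg) ltxx.
Qed.

Variable Lambda : set (character R G).

Lemma contains_c0_sequence : contains_c0 (C_spec m Lambda) ->
  exists (F : nat -> G -> R[i]) (C delta : R),
    [/\ forall n, continuous (F n),
        forall n gamma, ~ Lambda gamma -> fourier m (F n) gamma = 0,
        forall x N, \sum_(n < N) normc (F n x) <= C,
        0 < delta & forall n, exists x, delta <= complex.Re (F n x)].
Proof.
move=> [Y [YC _ [T [S [TY Tcont TK Scont]]]]].
have TC n : C_spec m Lambda (T (c0_unit R n)) by apply: YC; rewrite -TY; exists (c0_unit R n).
have /choice[g gP] : forall n, exists g : G -> R[i], [/\ continuous g,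
    {ae m, forall x, (T (c0_unit R n) : Linfty m) x = g x} &
    forall gamma, ~ Lambda gamma -> fourier m g gamma = 0] by move=> n; exact: TC.
have [r r0 Tr] : exists2 r : R, 0 < r & forall u, c0_sup u < r -> nrm (T u) < 1.
  have T1 : nbhs (0 : c0 R) [set u | nrm (T u) < 1].
    have /cvgrPdist_lt/(_ 1 ltr01) : T u @[u --> 0] --> T 0 by exact: Tcont.
    rewrite linear0; apply: filterS => u; rewrite sub0r normrN nrmE.
    by rewrite -[1](rmorph1 (real_complex R)) ltcR.
  have [r r0 rT] := nbhs0_real_ball T1.
  by exists r => // u ur; apply: rT; rewrite c0_nrmE ltcR.
have T_le u : c0_sup u <= 1 -> nrm (T u) <= 2 / r.
  move=> u1; have r2 : 0 < r / 2 by rewrite divr_gt0.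
  have : c0_sup ((r / 2)%:C *: u) < r.
    have := c0_normZ (r / 2)%:C u.
    rewrite /c0_norm Defs.normrE normc_real -rmorphM => /complexI ->.
    rewrite gtr0_norm//; apply: le_lt_trans (_ : r / 2 * 1 < _).
      by rewrite ler_pM2l.
    by rewrite mulr1 ltr_pdivrMr// ltr_pMr// ltr1n.
  move=> /Tr; rewrite linearZ nrmZ normc_real gtr0_norm// -ltr_pdivlMl// mulr1.
  by rewrite invf_div => /ltW.
have [q q0 Tq] : exists2 q : R, 0 < q & forall u, nrm (T u) < q -> c0_sup u < 1.
  have S0 : S 0 = 0 by rewrite -(linear0 T) TK.
  have Y0 : Y 0 by rewrite -TY; exists 0 => //; exact: linear0.
  have S1 : nbhs (0 : Linfty m) [set f | Y f -> c0_sup (S f) < 1].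
    have Sc : S f @[f --> within Y (nbhs 0)] --> (0 : c0 R).
      by rewrite -S0; exact: (subspace_continuousP _ _).1 Scont 0 Y0.
    move/cvgrPdist_lt : Sc => /(_ 1 ltr01).
    move=> Sc; have {}Sc : nbhs (0 : Linfty m) [set f | Y f -> `|0 - S f| < 1] by exact: Sc.
    apply: filterS Sc => f h Yf; have := h Yf; rewrite sub0r normrN c0_nrmE.
    by rewrite -[1](rmorph1 (real_complex R)) ltcR.
  have [q q0 qS] := nbhs0_real_ball S1.
  exists q => // u uq; rewrite -(TK u); apply: qS; first by rewrite nrmE ltcR.
  by rewrite -TY; exists u.
have low n : exists x, q / 2 <= normc (g n x).
  apply: contrapT => nx; have [_ Tg _] := gP n.
  have : nrm (T (c0_unit R n)) < q.
    apply: (@le_lt_trans _ _ (q / 2)).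
      apply: nrm_le; apply: ae_imp Tg _ => x ->; rewrite leNgt; apply/negP => lt.
      by apply: nx; exists x; exact: ltW.
    by rewrite ltr_pdivrMr// ltr_pMr// ltr1n.
  move=> /Tq; have := c0_sup_ge (c0_unit R n) n; rewrite /= eqxx normc1 => /le_lt_trans h /h.
  by rewrite ltxx.
have sum_le x N : \sum_(n < N) normc (g n x) <= 2 / r.
  have /choice[c cP] : forall n, exists c : R[i], normc c <= 1 /\ c * g n x = (normc (g n x))%:C.
    move=> n; have [->|g0] := eqVneq (g n x) 0.
      by exists 0; rewrite normc0 mul0r ler01.
    exists ((normc (g n x))%:C / g n x); split; last by rewrite divfK.
    rewrite normcM normcV normc_real ger0_norm ?normc_ge0// divff//.
    by apply: contra g0 => /eqP/eq0_normc ->.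
  pose u := \sum_(n < N) c n *: c0_unit R n.
  have u1 : c0_sup u <= 1.
    apply: c0_sup_le => k; rewrite c0_sum_unit; case: ifP => _; first by case: (cP k).
    by rewrite normc0.
  pose w y := \sum_(n < N) c n * g n y.
  have Tw : {ae m, forall y, (T u : Linfty m) y = w y}.
    rewrite linear_sum; apply: (Linfty_sum_ae N (F := fun n => T (c n *: c0_unit R n))
      (k := fun n y => c n * g n y)) => n.
    rewrite linearZ; have [_ Tg _] := gP n.
    apply: ae_imp2 (Linfty_scale_ae (c n) (T (c0_unit R n))) Tg _ => y h1 h2.
    by rewrite [LHS]h1 h2.
  have cw : continuous w.
    rewrite /w; elim: N {u u1 Tw w} => [|N IH].
      by move=> y; under eq_fun do rewrite big_ord0; exact: cvg_cst.
    move=> y; under eq_fun do rewrite big_ord_recr /=.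
    have [cg _ _] := gP N.
    exact: (@cvgD _ R[i] _ _ _ _ _ _ _ (IH y) (@cvgZl_tmp _ R[i] _ _ _ (c N) _ _ (cg y))).
  have wB : {ae m, forall y, normc (w y) <= 2 / r}.
    apply: ae_imp2 Tw (Linfty_ae_le (T u)) _ => y <- h.
    exact: le_trans h (T_le u u1).
  have := continuous_normc_le cw wB x.
  rewrite /w (eq_bigr (fun n : 'I_N => (normc (g n x))%:C)) => [|n _]; last by case: (cP n).
  by rewrite -rmorph_sum normc_real ger0_norm// sumr_ge0// => n _; exact: normc_ge0.
have /choice[x xP] := low.
pose z n := (normc (g n (x n)))%:C / g n (x n).
have gx0 n : g n (x n) != 0.
  apply/eqP => g0; have := xP n; rewrite g0 normc0 leNgt => /negP; apply.
  by rewrite divr_gt0.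
have z1 n : normc (z n) = 1.
  rewrite /z normcM normcV normc_real ger0_norm ?normc_ge0// divff//.
  by apply: contra (gx0 n) => /eqP/eq0_normc ->.
exists (fun n y => z n * g n y), (2 / r), (q / 2); split.
- by move=> n y; have [cg _ _] := gP n; exact: (@cvgZl_tmp _ R[i] _ _ _ (z n) _ _ (cg y)).
- move=> n gamma nL; have [cg _ g0] := gP n.
  have [M gM] := continuous_cess_le m G_compact cg.
  have := cintegralZ (z n) (cess_le_fourier gamma gM).
  rewrite -[X in _ = _ * X]/(fourier m (g n) gamma) g0// mulr0 => <-.
  by congr cintegral; apply/funext => y; rewrite mulrA.
- move=> y N; rewrite (eq_bigr (fun n : 'I_N => normc (g n y))) => [|n _]; first exact: sum_le.
  by rewrite normcM z1 mul1r.
- by rewrite divr_gt0.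
- by move=> n; exists (x n); rewrite /z divfK//; exact: xP.
Qed.

End c0_embedding.

Theorem theorem5p1 (R : realType) (G : topologicalZmodType)
    (G_compact : compact [set: G]) (G_hausdorff : hausdorff_space G)
    (m : probability (borel G) R) (m_haar : is_haar m)
    (Lambda : set (character R G)) (P : Linfty m -> Linfty m)
    (P_proj : bounded_projection (Linfty_spec m Lambda) (C_spec m Lambda) P) :
  ~ contains_c0 (C_spec m Lambda) /\
  forall f : Linfty m, Linfty_spec m Lambda f ->
    forall h : G -> R[i], riemann_integrable m h ->
      {ae m, forall x, f x = h x} ->
    C_spec m Lambda f.
Proof.
split=> [/(contains_c0_sequence G_compact m_haar)[F [C [delta [cF F0 FC delta0 Fdelta]]]]|f Lf h].
  exact: (no_spread_sequence G_compact m_haar cF FC P_proj F0 delta0 Fdelta).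
exact: (riemann_integrable_C_spec G_compact G_hausdorff m_haar P_proj Lf).
Qed.
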